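(* Let $B=\begin{bmatrix}0&b\\-c&0\end{bmatrix}$ with $b,c\in\mathbb{Z}_{\ge0}$, and consider the rank $2$ cluster pattern with principal coefficients at $t_0$ and initial exchange matrix $B$. For an $f$-vector $\mathbf{f}=\begin{bmatrix}f_1\\ f_2\end{bmatrix}$, the $F$-polynomial $F_{\mathbf{f}}(y_1,y_2)$ whose maximal degree vector is $\mathbf{f}$ is given by $$F_{\mathbf{f}}(y_1,y_2)=\sum_{(S_1,S_2)}y_1^{f_1-|S_1|}\,y_2^{|S_2|},$$ where the sum is over all compatible pairs $(S_1,S_2)$ in the maximal Dyck path $\mathcal{D}^{f_1\times f_2}$. (That is, whenever $\mathbf{f}_{i;t}=\mathbf{f}$ for some $i\in\{1,2\}$, $t\in\mathbb{T}_2$, the $F$-polynomial $F_{i;t}$ equals this sum.)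
   Context: Notation: $[a]_+=\max(a,0)$ for an integer $a$. Cluster pattern with principal coefficients (rank 2): $\mathbb{P}=\mathrm{Trop}(y_1,y_2)$ is the free abelian multiplicative group on $y_1,y_2$ with the addition $\prod y_j^{a_j}\oplus\prod y_j^{b_j}=\prod y_j^{\min(a_j,b_j)}$. Let $\mathbb{Q}(\mathbb{P})$ be the fraction field of the group ring $\mathbb{Z}\mathbb{P}$ and $\mathcal{F}$ the field of rational functions in two indeterminates over $\mathbb{Q}(\mathbb{P})$. A labeled seed is a triple $(\mathbf{x},\mathbf{y},B)$ with $\mathbf{x}=(x_1,x_2)$ a free generating set of $\mathcal{F}$ over $\mathbb{Q}(\mathbb{P})$, $\mathbf{y}\in\mathbb{P}^2$ and $B=(b_{ij})$ a $2\times2$ skew-symmetrizable integer matrix ($SB$ is skew-symmetric for some positive integer diagonal $S$). The mutation $\mu_k$ ($k=1,2$) sends it to $(\mathbf{x}',\mathbf{y}',B')$ with $b'_{ij}=-b_{ij}$ if $i=k$ or $j=k$, and $b'_{ij}=b_{ij}+[b_{ik}]_+b_{kj}+b_{ik}[-b_{kj}]_+$ otherwise; $y'_k=y_k^{-1}$ and $y'_j=y_jy_k^{[b_{kj}]_+}(y_k\oplus1)^{-b_{kj}}$ for $j\neq k$; $x'_k=\dfrac{y_k\prod_i x_i^{[b_{ik}]_+}+\prod_i x_i^{[-b_{ik}]_+}}{(y_k\oplus1)x_k}$ and $x'_j=x_j$ for $j\ne k$. $\mathbb{T}_2$ is the $2$-regular tree with edges labeled $1,2$, the two edges at each vertex having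 distinct labels. The cluster pattern assigns to each $t\in\mathbb{T}_2$ a labeled seed, with cluster $(x_{1;t},x_{2;t})$, so that seeds joined by an edge labeled $k$ are related by $\mu_k$; at the initial vertex $t_0$ the seed is $((x_1,x_2),(y_1,y_2),B)$, where $y_1,y_2$ are the generators of $\mathbb{P}$. The $x_{i;t}$ are the cluster variables. $F$-polynomials and $f$-vectors: $F_{i;t}(y_1,y_2)$ is obtained from the expression of $x_{i;t}$ in $x_1,x_2$ (and $y_1,y_2$) by setting $x_1=x_2=1$; it is a polynomial in $y_1,y_2$. The $f$-vector $\mathbf{f}_{i;t}=\begin{bmatrix}f_{1i;t}\\ f_{2i;t}\end{bmatrix}$ has $f_{ki;t}$ equal to the maximal degree of $y_k$ in $F_{i;t}$. Dyck paths: for integers $a_1,a_2\ge0$, a Dyck path of type $a_1\times a_2$ is a lattice path (unit steps right and up) from $(0,0)$ to $(a_1,a_2)$ that does not go above the diagonal joining $(0,0)$ and $(a_1,a_2)$. The maximal Dyck path $\mathcal{D}=\mathcal{D}^{a_1\times a_2}$ is the one closest to the diagonal: every lattice point strictly above $\mathcal{D}$ is strictly above the diagonal. Let $\mathcal{D}_1=\{u_1,\dots,u_{a_1}\}$ be its set of horizontal edges (left to right) and $\mathcal{D}_2=\{v_1,\dots,v_{a_2}\}$ its set of vertical edges (bottom to top). For lattice points $A,B$ on $\mathcal{D}$, $AB$ is the subpath of $\mathcal{D}$ starting at $A$ and going in the upper-right direction along $\mathcal{D}$ until it reaches $B$; if $(a_1,a_2)$ is reached before $B$, one restarts from $(0,0)$.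 The points $(0,0)$ and $(a_1,a_2)$ are regarded as the same point, and if $A=B$ then $AA$ is the full closed loop starting at $A$, passing $(a_1,a_2)$, and ending at $A$ (of length $a_1+a_2$). $(AB)_1$ and $(AB)_2$ are the sets of horizontal, respectively vertical, edges in $AB$, and $AB^\circ$ is the set of lattice points on $AB$ other than the endpoints $A$ and $B$. Compatibility: for $S_1\subseteq\mathcal{D}_1$, $S_2\subseteq\mathcal{D}_2$, the pair $(S_1,S_2)$ is compatible if for every $u\in S_1$ and $v\in S_2$, with $E$ the left endpoint of $u$ and $F$ the upper endpoint of $v$, there is a lattice point $A\in EF^\circ$ such that $$|(AF)_1|=b\,|(AF)_2\cap S_2|\quad\text{or}\quad|(EA)_2|=c\,|(EA)_1\cap S_1|.$$ *)

(* Defs.v *)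
From Stdlib Require Import ClassicalEpsilon.
From mathcomp Require Import all_boot all_order all_algebra.
From mathcomp Require Import mpoly.

Set Implicit Arguments.
Unset Strict Implicit.
Unset Printing Implicit Defensive.

Import Order.TTheory GRing.Theory Num.Theory.
Local Open Scope ring_scope.

(* Throughout, the indices 1, 2 are the elements 0, 1 of 'I_2. *)

(* The group Trop(y_1, y_2): the monomial y_1 ^ a_1 * y_2 ^ a_2 is stored as its
   row of exponents, so that the product is +, the unit is 0, the inverse is -
   and the n-th power is *~ n. *)
Definition Trop := 'rV[int]_2.

Definition trop_add (p q : Trop) : Trop :=
  \row_j Num.min (p 0 j) (q 0 j).

(* The group ring of Trop(y_1, y_2) over the integers is the ring of Laurent
   polynomials in y_1, y_2; its fraction field is that of Z[y_1, y_2]. *)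
Definition QP := {fraction {mpoly int[2]}}.

Definition QP_of_Trop (p : Trop) : QP :=
  \prod_(j < 2) (FracField.tofrac ('X_j : {mpoly int[2]})) ^ (p 0 j).

Definition ambient := {fraction {mpoly QP[2]}}.

Definition ambient_of_QP (a : QP) : ambient :=
  FracField.tofrac (a%:MP : {mpoly QP[2]}).

Definition eval_cluster (x : 'I_2 -> ambient) (p : {mpoly QP[2]}) : ambient :=
  mmap ambient_of_QP x p.

Definition free_generating_set (x : 'I_2 -> ambient) : Prop :=
  (forall p, eval_cluster x p = 0 -> p = 0) /\
  (forall z, exists p q,
     eval_cluster x q != 0 /\ z = eval_cluster x p / eval_cluster x q).

Definition skew_symmetrizable (B : 'M[int]_2) : Prop :=
  exists d : 'rV[int]_2,
    (forall i, 0 < d 0 i) /\ (diag_mx d *m B)^T = - (diag_mx d *m B).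

Record seed := Seed {
  cluster : {ffun 'I_2 -> ambient};
  coeffs : {ffun 'I_2 -> Trop};
  exchange : 'M[int]_2
}.

Definition labeled_seed (s : seed) : Prop :=
  free_generating_set (cluster s) /\ skew_symmetrizable (exchange s).

Definition pos_part (a : int) : int := Num.max a 0.

Definition mutate_matrix (k : 'I_2) (B : 'M[int]_2) : 'M[int]_2 :=
  \matrix_(i, j)
    if (i == k) || (j == k) then - B i j
    else B i j + pos_part (B i k) * B k j + B i k * pos_part (- B k j).

Definition mutate_coeffs (k : 'I_2) (s : seed) : {ffun 'I_2 -> Trop} :=
  let y := coeffs s in let B := exchange s in
  [ffun j => if j == k then - y k
             else y j + y k *~ pos_part (B k j)
                      + trop_add (y k) 0 *~ (- B k j)].

Definition mutate_cluster (k : 'I_2) (s : seed) : {ffun 'I_2 -> ambient} :=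
  let x := cluster s in let y := coeffs s in let B := exchange s in
  let embed p := ambient_of_QP (QP_of_Trop p) in
  [ffun j => if j == k then
     (embed (y k) * \prod_i x i ^ pos_part (B i k)
        + \prod_i x i ^ pos_part (- B i k))
     / (embed (trop_add (y k) 0) * x k)
   else x j].

Definition mutation (k : 'I_2) (s : seed) : seed :=
  Seed (mutate_cluster k s) (mutate_coeffs k s) (mutate_matrix k (exchange s)).

(* The vertices of the 2-regular tree T_2 are the integers, with an edge between
   t and t + 1 for each t. Up to an isomorphism of trees fixing t_0 = 0 the only
   edge labeling is the one below. *)
Definition edge_label (t : int) : 'I_2 := if odd `|t|%N then 1 else 0.

Definition cluster_pattern (Sigma : int -> seed) : Prop :=
  (forall t, labeled_seed (Sigma t)) /\
  (forall t, Sigma (t + 1) = mutation (edge_label t) (Sigma t) /\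
             Sigma t = mutation (edge_label t) (Sigma (t + 1))).

Definition principal_seed (B : 'M[int]_2) : seed :=
  Seed [ffun i => FracField.tofrac ('X_i : {mpoly QP[2]})]
       [ffun i => delta_mx 0 i]
       B.

Definition exchange_matrix (b c : nat) : 'M[int]_2 :=
  \matrix_(i, j)
    if (i == 0) && (j == 1) then b%:Z
    else if (i == 1) && (j == 0) then - c%:Z
    else 0.

(* v is the value at x_1 = x_2 = 1 of z, a rational function in x_1, x_2. *)
Definition specialized_at_1 (z : ambient) (v : QP) : Prop :=
  exists p q : {mpoly QP[2]},
    [/\ q.@[fun=> 1] != 0,
        z = FracField.tofrac p / FracField.tofrac q
      & v = p.@[fun=> 1] / q.@[fun=> 1]].

(* The F-polynomial is a priori only the value in QP of a cluster variable at
   x_1 = x_2 = 1; the (unique) polynomial equal to it is selected by epsilon,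
   which gives an unspecified polynomial for a value that is not one. *)
Definition F_polynomial (Sigma : int -> seed) (i : 'I_2) (t : int) :
    {mpoly int[2]} :=
  epsilon (inhabits 0)
    (fun P => specialized_at_1 (cluster (Sigma t) i) (FracField.tofrac P)).

Definition max_degree (k : 'I_2) (P : {mpoly int[2]}) : nat :=
  \max_(m <- msupp P) m k.

Definition f_vector (Sigma : int -> seed) (i : 'I_2) (t : int) : 'cV[nat]_2 :=
  \col_k max_degree k (F_polynomial Sigma i t).

(* A lattice path from (0,0) to (a1, a2) is the sequence w of its a1 + a2 steps:
   true is a unit step to the right, false a unit step up. *)

Definition path_point (w : seq bool) (i : nat) : nat * nat :=
  (count id (take i w), count negb (take i w)).

Definition above_diagonal (a1 a2 : nat) (p : nat * nat) : bool :=
  (p.1 * a2 < p.2 * a1)%N.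

Definition is_Dyck_path (a1 a2 : nat) (w : seq bool) : bool :=
  [&& count id w == a1, count negb w == a2 &
      [forall i : 'I_(a1 + a2).+1, ~~ above_diagonal a1 a2 (path_point w i)]].

Definition above_path (a1 a2 : nat) (w : seq bool) (p : nat * nat) : bool :=
  [forall i : 'I_(a1 + a2).+1,
     ((path_point w i).1 == p.1) ==> ((path_point w i).2 < p.2)%N].

(* Points "above" the path or the diagonal lie in the rectangle they span. *)
Definition is_maximal_Dyck_path (a1 a2 : nat) (w : seq bool) : bool :=
  is_Dyck_path a1 a2 w &&
  [forall x : 'I_a1.+1, forall y : 'I_a2.+1,
     above_path a1 a2 w (val x, val y) ==> above_diagonal a1 a2 (val x, val y)].

(* The path is unique; the default value is never reached. *)
Definition maximal_Dyck_path (a1 a2 : nat) : (a1 + a2).-tuple bool :=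
  odflt [tuple of nseq (a1 + a2) true]
    [pick w : (a1 + a2).-tuple bool | is_maximal_Dyck_path a1 a2 w].

Section Compatibility.

Variables (b c n : nat) (w : n.-tuple bool).

(* As its two endpoints are identified, the path w is a closed loop. The i-th
   edge and the i-th lattice point (the starting point of that edge, namely
   path_point w i) are both indexed by i : 'I_n, counting from 0; the edge i
   goes from the point i to the point ordS i. *)

Definition horizontal_edges : {set 'I_n} := [set e | tnth w e].
Definition vertical_edges : {set 'I_n} := [set e | ~~ tnth w e].

Definition subpath_length (A B : 'I_n) : nat :=
  (if A < B then B - A else n + B - A)%N.

(* The edges of the subpath AB; read as points, A followed by the interior. *)
Definition subpath (A B : 'I_n) : seq 'I_n :=
  traject (@ordS n) A (subpath_length A B).

Definition interior (A B : 'I_n) : seq 'I_n := behead (subpath A B).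

Definition subpath_hor (A B : 'I_n) : {set 'I_n} :=
  [set e in subpath A B] :&: horizontal_edges.
Definition subpath_ver (A B : 'I_n) : {set 'I_n} :=
  [set e in subpath A B] :&: vertical_edges.

Definition compatible (S1 S2 : {set 'I_n}) : bool :=
  [forall u in S1, forall v in S2,
     let E := u in let F := ordS v in
     [exists A in interior E F,
        (#|subpath_hor A F| == b * #|subpath_ver A F :&: S2|)%N ||
        (#|subpath_ver E A| == c * #|subpath_hor E A :&: S1|)%N]].

Definition compatible_pair (S : {set 'I_n} * {set 'I_n}) : bool :=
  [&& S.1 \subset horizontal_edges, S.2 \subset vertical_edges
    & compatible S.1 S.2].

End Compatibility.

(* Main.v *)
From Stdlib Require Import ClassicalEpsilon.
Require Import Defs.
From mathcomp Require Import all_boot all_order all_algebra.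
From mathcomp Require Import mpoly.
From mathcomp Require Import zify ring.

(** Why the theorem is true.

    Write F_a(y_1, y_2), for a = (a_1, a_2), for the sum over the compatible
    pairs in the maximal Dyck path of type a_1 x a_2, and F_a^{c,b} for the sum
    in which b and c are exchanged. The F-polynomials of the pattern are
    determined by their exchange relations, so that it suffices to see that the
    sums F_a, with a running through the denominator vectors, satisfy the same
    relations. This follows from a single identity, the change of F under the
    mutation of the initial seed (compatible_sum_shift): for a_1 <= b a_2,

      F_a(y_1, y_2) = (1 + y_1)^{a_1}
        F^{c,b}_{(a_2, b a_2 - a_1)}(y_2 y_1^b (1 + y_1)^{-b}, y_1^{-1}).

    It turns an exchange relation into the preceding one for the exchanged pair
    (c, b), and the first relation is checked by hand (forward_exchange). The
    relations in the other direction of the tree follow by reversal of the paths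
    (backward_exchange).

    The identity is combinatorial. Reversing the path exchanges the two kinds of
    edges (path_sum_dual), so that the mutation at the other vertex may be
    considered, which relates a to (a_1, c a_1 - a_2) when a_2 <= c a_1. Fix the
    set S_1 of selected horizontal edges and sum over S_2 only. Replace each edge
    of S_1 by c opening brackets and each vertical edge by a closing bracket, and
    match brackets cyclically. A vertical edge whose bracket is matched within
    its own column cannot belong to S_2; one whose bracket is unmatched is not
    restricted at all; and for the others (S_1, S_2) is compatible if and only if
    every selected arc spans at least b times as many horizontal edges as there
    are selected arcs nested in it, itself included. This condition is invariant
    under reading the word backwards with the two kinds of brackets exchanged. If
    the heights of the columns of the path are h_i, then the reversed word is,
    after cancellation of the brackets inside the columns, the word of the path
    with column heights c - h_i, in reversed order, and of the complement of S_1;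
    and this path is the maximal Dyck path of type a_1 x (c a_1 - a_2)
    (heights_complement). Since the number of unmatched brackets is known,
    comparing the two sums gives the identity (clean_sum_dual,
    path_sum_complement). In the proof the matching never appears: innermost arcs
    are contracted one at a time (clean_elim).

    On the side of the cluster pattern, everything is evaluated at
    x_1 = x_2 = 1. The coefficients then follow the denominator vectors, and in
    each direction of the tree the values are computed by the exchange relations
    above: forever if b c >= 4, and until the initial seed comes back if
    b c < 4. Finally F_a has degree a_1 in y_1 and a_2 in y_2, because its
    coefficients are nonnegative and the pairs of the empty set with the empty
    set and with the set of all vertical edges are compatible; hence the
    f-vector of a cluster variable with F-polynomial F_a is a. *)

Set Implicit Arguments.
Unset Strict Implicit.
Unset Printing Implicit Defensive.

Import Order.TTheory GRing.Theory Num.Theory.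

(** * Maximal Dyck paths *)

Definition column_word (hs : seq nat) : bitseq :=
  flatten [seq true :: nseq h false | h <- hs].

(** If p.1 + p.2 = i and a1 + a2 > 0, this says that p.2 is the integer part of
    i * a2 / (a1 + a2): p is the highest point of its antidiagonal which is not
    above the diagonal. *)
Definition hugs_diagonal (a1 a2 : nat) (p : nat * nat) : bool :=
  (p.2 * a1 <= p.1 * a2) && (p.1 * a2 < p.2.+1 * a1 + a2).

Definition hugging (a1 a2 : nat) (w : bitseq) : Prop :=
  forall i, i <= size w -> hugs_diagonal a1 a2 (path_point w i).

Lemma path_point_sum w i : i <= size w ->
  (path_point w i).1 + (path_point w i).2 = i.
Proof.
move=> le_i; rewrite /path_point /= -[RHS](size_takel le_i).
exact: (count_predC id).
Qed.

Lemma path_point_mono w i j : i <= j ->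
  (path_point w i).1 <= (path_point w j).1 /\ (path_point w i).2 <= (path_point w j).2.
Proof.
move=> le_ij; have [s] : exists s, take j w = take i w ++ s.
  by exists (drop i (take j w)); rewrite -(take_takel w le_ij) cat_take_drop.
by rewrite /path_point => ->; rewrite !count_cat !leq_addr.
Qed.

Lemma path_point_step w i : i < size w ->
  path_point w i.+1 = ((path_point w i).1 + nth false w i, (path_point w i).2 + ~~ nth false w i).
Proof.
by move=> lt_i; rewrite /path_point (take_nth false) // -cats1 !count_cat /= !addn0.
Qed.

(** Each antidiagonal contains only one point near the diagonal in the sense of
    hugs_diagonal, and a path is determined by its points. *)
Lemma hugging_inj a1 a2 w w' : size w = size w' ->
  hugging a1 a2 w -> hugging a1 a2 w' -> w = w'.
Proof.
move=> sz hw hw'; have ptE i : i <= size w -> path_point w i = path_point w' i.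
  move=> le_i; have le_i' : i <= size w' by rewrite -sz.
  have := hw _ le_i; have := hw' _ le_i'.
  have := path_point_sum le_i; have := path_point_sum le_i'.
  case: (path_point w i) (path_point w' i) => x y [x' y'].
  rewrite /hugs_diagonal /= => s1 s2 /andP[h1 h2] /andP[h3 h4].
  have [] : y = y' /\ x = x'; last by move=> -> ->.
  have [lt_y | lt_y | ?] := ltngtP y y'; last by split; lia.
    have : (x'.+1 * a2 <= x * a2) by rewrite leq_mul2r; lia.
    have : (y.+1 * a1 <= y' * a1) by rewrite leq_mul2r; lia.
    lia.
  have : (x.+1 * a2 <= x' * a2) by rewrite leq_mul2r; lia.
  have : (y'.+1 * a1 <= y * a1) by rewrite leq_mul2r; lia.
  lia.
apply: (@eq_from_nth _ false) => // i lt_i.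
have := ptE _ lt_i; rewrite !path_point_step -?sz // ptE; last exact: ltnW.
by case=> /addnI; case: (nth _ w i) (nth _ w' i) => [] [].
Qed.

(** If a point (x, y) of the path is too low, then (x - 1, y + 1) is above the
    path without being above the diagonal. *)
Lemma maximal_hugging a1 a2 (w : (a1 + a2).-tuple bool) :
  0 < a1 + a2 -> is_maximal_Dyck_path a1 a2 w -> hugging a1 a2 w.
Proof.
move=> n_gt0 /andP[/and3P[/eqP c1 /eqP c2 /forallP below] /forallP maxw] i.
rewrite size_tuple => le_i; have := below (Ordinal (le_i : i < (a1 + a2).+1)).
rewrite -[nat_of_ord _]/i; case ptE : (path_point w i) => [x y].
rewrite /above_diagonal -leqNgt /= /hugs_diagonal => -> /=.
have [x1 y2] : x <= a1 /\ y <= a2.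
  have := path_point_mono w le_i; rewrite ptE.
  have -> // : path_point w (a1 + a2) = (a1, a2).
  by rewrite /path_point take_oversize ?size_tuple // c1 c2.
rewrite ltnNge; apply/negP => le_xy.
have x_gt0 : 0 < x.
  rewrite lt0n; apply/negP=> /eqP x0; move: le_xy.
  by rewrite x0 mul0n leqn0 addn_eq0 muln_eq0 /=; lia.
have le_y : y.+1 <= a2.
  have : y.+1 * a1 <= a1.-1 * a2.
    have : x.-1 * a2 <= a1.-1 * a2 by rewrite leq_mul2r; lia.
    have : x * a2 = x.-1 * a2 + a2 by rewrite -{1}(prednK x_gt0) mulSn addnC.
    lia.
  have a1_gt0 : 0 < a1 by lia.
  move=> H; rewrite leqNgt; apply/negP=> lt_a2.
  have : a2.+1 * a1 <= y.+1 * a1 by rewrite leq_mul2r; lia.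
  have : a1 * a2 = a1.-1 * a2 + a2 by rewrite -{1}(prednK a1_gt0) mulSn addnC.
  lia.
have lt_x : x.-1 < a1.+1 by lia.
have /forallP/(_ (Ordinal (le_y : y.+1 < a2.+1))) := maxw (Ordinal lt_x).
rewrite /above_diagonal /= => /implyP H.
suff : x.-1 * a2 < y.+1 * a1.
  have : x * a2 = x.-1 * a2 + a2 by rewrite -{1}(prednK x_gt0) mulSn addnC.
  lia.
apply: H; apply/forallP => j; case ptj : (path_point w j) => [x' y'].
apply/implyP => /= /eqP xj; rewrite ltnS.
have lt_ji : j < i.
  rewrite ltnNge; apply/negP=> /(path_point_mono w)[]; rewrite ptj ptE /=; lia.
by have [] := path_point_mono w (ltnW lt_ji); rewrite ptj ptE.
Qed.

(** If (x, y) is not above the diagonal, then the path crosses the antidiagonal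
    of (x, y) at this point or to the left of it, and its height is at least y
    when it reaches the abscissa x. *)
Lemma hugging_maximal a1 a2 (w : (a1 + a2).-tuple bool) :
  count id w = a1 -> hugging a1 a2 w -> is_maximal_Dyck_path a1 a2 w.
Proof.
move=> c1 hw; have c2 : count negb w = a2.
  have : count id w + count negb w = size w := count_predC id w.
  by rewrite size_tuple c1 => /addnI.
apply/andP; split.
  rewrite /is_Dyck_path c1 c2 !eqxx; apply/forallP => -[i lt_i] /=.
  rewrite /above_diagonal -leqNgt; have := hw i; rewrite size_tuple.
  by move=> /(_ lt_i)/andP[].
apply/forallP => -[x le_x]; apply/forallP => -[y le_y] /=.
apply/implyP => /forallP above; rewrite /above_diagonal /= ltnNge; apply/negP=> le_yx.
have le_i : x + y <= size w by rewrite size_tuple; lia.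
have := path_point_sum le_i; have := hw _ le_i.
set p := path_point w (x + y) => /andP[h1 h2] sum_p.
have y_p : y <= p.2.
  rewrite leqNgt; apply/negP=> lt_y.
  have : (p.2.+1 * a1 <= y * a1) by rewrite leq_mul2r; lia.
  have : (x.+1 * a2 <= p.1 * a2) by rewrite leq_mul2r; lia.
  lia.
(* The first point from the antidiagonal of (x, y) on which has abscissa x. *)
pose P j := (x + y <= j) && (x <= (path_point w j).1).
have exP : exists j, P j.
  exists (size w); rewrite /P le_i /path_point take_size c1 /=; lia.
have [j /andP[le_j x_j] min_j] := ex_minnP exP.
have j_n : j <= size w.
  by apply: min_j; rewrite /P le_i /path_point take_size c1 /=; lia.
have x_jE : (path_point w j).1 = x.
  move: le_j; rewrite leq_eqVlt => /orP[/eqP ej | lt_j].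
    by move: x_j; rewrite -ej -/p; lia.
  have [j' def_j] : exists j', j = j'.+1 by exists j.-1; lia.
  have : ~~ P j' by apply/negP=> /min_j; lia.
  rewrite /P -ltnS -def_j lt_j andTb -ltnNge => x_j'.
  move: x_j; rewrite def_j path_point_step; last by rewrite -def_j.
  by case: (path_point w j') x_j' => u v /=; case: (nth _ _ _) => /=; lia.
have lt_jn : j < (a1 + a2).+1 by have := j_n; rewrite size_tuple.
have := above (Ordinal lt_jn); rewrite -[nat_of_ord _]/j.
have y_j : y <= (path_point w j).2 := leq_trans y_p (path_point_mono w le_j).2.
case: (path_point w j) x_jE y_j => x' y' /= -> ?; rewrite eqxx /=; lia.
Qed.

(** A path below the diagonal can rise up to the integer part of i * a2 / a1 at
    the abscissa i; these are the lengths of its vertical parts when it does. *)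
Definition heights a1 a2 := [seq i.+1 * a2 %/ a1 - i * a2 %/ a1 | i <- iota 0 a1].

Lemma column_hugging a1 a2 k : 0 < a1 ->
  let w := column_word [seq i.+1 * a2 %/ a1 - i * a2 %/ a1 | i <- iota 0 k] in
  [/\ count id w = k, count negb w = k * a2 %/ a1 & hugging a1 a2 w].
Proof.
move=> a1_gt0 /=.
pose col k := column_word [seq i.+1 * a2 %/ a1 - i * a2 %/ a1 | i <- iota 0 k].
rewrite -/(col k); elim: k => [|k [c1 c2 hw]].
  rewrite mul0n div0n; split=> // -[|//] _.
  by rewrite /hugs_diagonal /path_point /= mul0n mul1n; lia.
have colS : col k.+1 = col k ++ true :: nseq (k.+1 * a2 %/ a1 - k * a2 %/ a1) false.
  rewrite /col -[in LHS]addn1 iotaD map_cat /column_word map_cat flatten_cat /= add0n.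
  by rewrite cats0.
have le_div : k * a2 %/ a1 <= k.+1 * a2 %/ a1 by apply: leq_div2r; lia.
have h1 := leq_divM (k * a2) a1; have h2 := ltn_ceil (k * a2) a1_gt0.
have h3 := leq_divM (k.+1 * a2) a1.
rewrite colS !count_cat /= !count_nseq c1 c2; split; [lia | lia |].
move=> i _; have [le_i | lt_i] := leqP i (size (col k)).
  have -> : path_point (col k ++ true :: nseq (k.+1 * a2 %/ a1 - k * a2 %/ a1) false) i
            = path_point (col k) i.
    by rewrite /path_point takel_cat.
  exact: hw.
rewrite /path_point take_cat ltnNge (ltnW lt_i) /= !count_cat c1 c2.
have [j ->] : exists j, i - size (col k) = j.+1 by exists (i - size (col k)).-1; lia.
rewrite /= add0n add1n.
set t := take j _.
have [id_t le_t] : count id t = 0 /\ count negb t <= k.+1 * a2 %/ a1 - k * a2 %/ a1.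
  have [le_j | lt_j] := leqP j (k.+1 * a2 %/ a1 - k * a2 %/ a1).
    by rewrite /t take_nseq // !count_nseq mul0n mul1n.
  by rewrite /t take_oversize ?size_nseq ?(ltnW lt_j) // !count_nseq mul0n mul1n.
rewrite id_t addn1 /hugs_diagonal /=; apply/andP; split.
  apply: leq_trans h3; rewrite leq_mul2r; lia.
rewrite mulSn addnC ltn_add2r; apply: leq_trans h2 _.
rewrite leq_mul2r; lia.
Qed.

Lemma heights_spec a1 a2 : 0 < a1 ->
  [/\ count id (column_word (heights a1 a2)) = a1,
      count negb (column_word (heights a1 a2)) = a2
    & hugging a1 a2 (column_word (heights a1 a2))].
Proof.
by move=> a1_gt0; have [] := column_hugging a2 a1 a1_gt0; rewrite mulKn.
Qed.

Lemma hugging_ver a2 : 0 < a2 -> hugging 0 a2 (nseq a2 false).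
Proof.
move=> a2_gt0 i; rewrite size_nseq => le_i.
by rewrite /hugs_diagonal /path_point take_nseq // !count_nseq /= !muln0 !mul0n add0n; lia.
Qed.

Lemma maximal_Dyck_path_maximal a1 a2 : 0 < a1 + a2 ->
  is_maximal_Dyck_path a1 a2 (maximal_Dyck_path a1 a2).
Proof.
move=> n_gt0; rewrite /maximal_Dyck_path; case: pickP => //= none.
have [w szw [c1 hw]] : exists2 w, size w = a1 + a2 & count id w = a1 /\ hugging a1 a2 w.
  have [a10 | a1_gt0] := posnP a1.
    by exists (nseq a2 false); rewrite ?a10 ?size_nseq ?count_nseq //; split=> //;
       apply: hugging_ver; rewrite a10 in n_gt0.
  have [c1 c2 hw] := heights_spec a2 a1_gt0.
  exists (column_word (heights a1 a2)) => //.
  by rewrite -(count_predC id) c1; congr (_ + _).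
have := none (Tuple (introT eqP szw)).
by rewrite hugging_maximal.
Qed.

Lemma maximal_Dyck_path_spec a1 a2 : 0 < a1 + a2 ->
  [/\ count id (maximal_Dyck_path a1 a2) = a1,
      count negb (maximal_Dyck_path a1 a2) = a2
    & hugging a1 a2 (maximal_Dyck_path a1 a2)].
Proof.
move=> n_gt0; have max := maximal_Dyck_path_maximal n_gt0.
have hug := maximal_hugging n_gt0 max.
by case/andP: max => /and3P[/eqP c1 /eqP c2 _] _.
Qed.

Lemma maximal_Dyck_path_hugging a1 a2 w : 0 < a1 + a2 -> size w = a1 + a2 ->
  hugging a1 a2 w -> maximal_Dyck_path a1 a2 = w :> bitseq.
Proof.
move=> n_gt0 sz hw; have [_ _ hmax] := maximal_Dyck_path_spec n_gt0.
by apply: hugging_inj hmax hw; rewrite size_tuple.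
Qed.

Lemma maximal_Dyck_path_columns a1 a2 : 0 < a1 ->
  maximal_Dyck_path a1 a2 = column_word (heights a1 a2) :> bitseq.
Proof.
move=> a1_gt0; have [c1 c2 hw] := heights_spec a2 a1_gt0.
apply: maximal_Dyck_path_hugging hw; first by lia.
by rewrite -(count_predC id) c1; congr (_ + _).
Qed.

(** Reversing a path and exchanging the two kinds of steps sends its points
    (x, y) to (a2 - y, a1 - x), and hugs_diagonal is invariant under this map. *)
Lemma maximal_Dyck_path_rev a1 a2 : 0 < a1 + a2 ->
  rev (map negb (maximal_Dyck_path a1 a2)) = maximal_Dyck_path a2 a1.
Proof.
move=> n_gt0; have [c1 c2 hw] := maximal_Dyck_path_spec n_gt0.
symmetry; apply: maximal_Dyck_path_hugging; first by lia.
  by rewrite size_rev size_map size_tuple addnC.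
set w := val (maximal_Dyck_path a1 a2) in c1 c2 hw *.
have sz_w : size w = a1 + a2 by rewrite /w size_tuple.
move=> i; rewrite size_rev size_map => le_i.
have := hw _ (leq_subr i (size w)).
have := c1; have := c2; rewrite -{1 2}(cat_take_drop (size w - i) w) !count_cat.
rewrite /hugs_diagonal /path_point take_rev size_map -map_drop !count_rev !count_map /=.
rewrite (eq_count (a1 := preim negb id) (a2 := negb)) //.
rewrite (eq_count (a1 := preim negb negb) (a2 := id)); last by move=> x; apply: negbK.
set x := count id _; set y := count negb _; set x' := count id _; set y' := count negb _.
move=> d2 d1 /andP[h1 h2]; apply/andP; rewrite -d1 -d2 in h1 h2 *.
nia.
Qed.

Lemma size_heights a1 a2 : size (heights a1 a2) = a1.
Proof. by rewrite size_map size_iota. Qed.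

Lemma sumn_heights a1 a2 : 0 < a1 -> sumn (heights a1 a2) = a2.
Proof.
move=> a1_gt0; have [_ cE _] := heights_spec a2 a1_gt0; rewrite -[RHS]cE.
elim: (heights a1 a2) => //= h hs ->.
by rewrite count_cat count_nseq /= mul1n.
Qed.

Lemma heights_le a1 a2 c : 0 < a1 -> a2 <= c * a1 -> all (fun h => h <= c) (heights a1 a2).
Proof.
move=> a1_gt0 le_a; apply/allP => _ /mapP[i _ ->].
rewrite leq_subLR addnC; rewrite -(divnMDl _ _ a1_gt0); apply: leq_div2r; lia.
Qed.

(** Replacing a2 by c * a1 - a2 turns integer parts from below into integer parts
    from above, which reading the columns backwards turns back. *)
Lemma heights_complement a1 a2 c : 0 < a1 -> a2 <= c * a1 ->
  rev (map (subn c) (heights a1 a2)) = heights a1 (c * a1 - a2).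
Proof.
move=> a1_gt0 le_a.
(* floor(i (c a1 - a2) / a1) + a2 = c i + floor((a1 - i) a2 / a1) *)
have HE i : i <= a1 -> i * (c * a1 - a2) %/ a1 + a2 = c * i + (a1 - i) * a2 %/ a1.
  move=> le_i; rewrite -[X in _ + X = _](mulKn a2 a1_gt0) addnC -divnMDl //.
  rewrite mulKn // -divnMDl //; congr (_ %/ _).
  rewrite mulnBl mulnBr.
  have : i * a2 <= i * (c * a1) by rewrite leq_mul2l le_a orbT.
  have : i * a2 <= a1 * a2 by rewrite leq_mul2r le_i orbT.
  lia.
apply: (@eq_from_nth _ 0); first by rewrite size_rev size_map !size_heights.
move=> i; rewrite size_rev size_map size_heights => lt_i.
have nthE a k : k < a1 -> nth 0 (heights a1 a) k = k.+1 * a %/ a1 - k * a %/ a1.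
  by move=> lt_k; rewrite (nth_map 0) ?size_iota // nth_iota.
rewrite nth_rev; last by rewrite size_map size_heights.
rewrite size_map size_heights (nth_map 0); last by rewrite size_heights; lia.
rewrite !nthE //; last by lia.
have := HE i.+1 lt_i; have := HE i (ltnW lt_i).
have -> : (a1 - i.+1).+1 = a1 - i by lia.
have : (a1 - i.+1) * a2 %/ a1 <= (a1 - i) * a2 %/ a1 by apply: leq_div2r; rewrite leq_mul2r; lia.
have : i * (c * a1 - a2) %/ a1 <= i.+1 * (c * a1 - a2) %/ a1.
  by apply: leq_div2r; rewrite leq_mul2r; lia.
lia.
Qed.

Local Open Scope ring_scope.

(** * Compatibility as a condition on segments of a closed path *)

(** The steps of a closed path carry two integers: (c, 1) for a selected
    horizontal edge and (0, 1) for another one, (-1, -b) for a selected vertical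
    edge and (-1, 0) for another one. The sum of the first integers over a
    subpath EA is then c |(EA)_1 /\ S_1| - |(EA)_2|, and the sum of the second
    ones over a subpath AF is |(AF)_1| - b |(AF)_2 /\ S_2|. *)
Definition sum1 (t : seq (int * int)) : int := \sum_(e <- t) e.1.
Definition sum2 (t : seq (int * int)) : int := \sum_(e <- t) e.2.

Lemma sum1_cat s t : sum1 (s ++ t) = sum1 s + sum1 t.
Proof. by rewrite /sum1 big_cat. Qed.
Lemma sum2_cat s t : sum2 (s ++ t) = sum2 s + sum2 t.
Proof. by rewrite /sum2 big_cat. Qed.
Lemma sum1_cons e t : sum1 (e :: t) = e.1 + sum1 t.
Proof. by rewrite /sum1 big_cons. Qed.
Lemma sum2_cons e t : sum2 (e :: t) = e.2 + sum2 t.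
Proof. by rewrite /sum2 big_cons. Qed.
Lemma sum1_nil : sum1 [::] = 0. Proof. by rewrite /sum1 big_nil. Qed.
Lemma sum2_nil : sum2 [::] = 0. Proof. by rewrite /sum2 big_nil. Qed.
Definition step_sumE := (sum1_cat, sum2_cat, sum1_cons, sum2_cons, sum1_nil, sum2_nil).

(** A subpath EF violates compatibility if neither of these sums vanishes at an
    interior point. The first sum starts with a value >= 0 and never decreases
    by more than 1; the second one, read backwards from F, starts with a value
    <= 0 and never increases by more than 1. So this means that all values of
    the first sum are positive and all values of the second one negative. *)
Definition conflict (t : seq (int * int)) : bool :=
  (1 < size t)%N &&
  all (fun i => (0 < sum1 (take i t)) && (sum2 (drop i t) < 0))
      (iota 1 (size t).-1).

(** The word is a closed loop; rot k s reads it from its k-th point on. *)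
Definition clean (s : seq (int * int)) : bool :=
  all (fun k => all (fun l => ~~ conflict (take l (rot k s))) (iota 0 (size s).+1))
      (iota 0 (size s).+1).

Lemma neq_nil (s : seq (int * int)) : (s != [::]) = (0 < size s)%N.
Proof. by case: s. Qed.

Lemma conflictP t :
  reflect ((1 < size t)%N /\ forall t1 t2 : seq (int * int), t = t1 ++ t2 -> t1 != [::] ->
             t2 != [::] -> 0 < sum1 t1 /\ sum2 t2 < 0)
          (conflict t).
Proof.
apply: (iffP andP) => -[szt Ht]; split=> //.
  move=> t1 t2 def_t; rewrite !neq_nil => t1n t2n.
  have /allP/(_ (size t1)) := Ht; rewrite mem_iota def_t take_size_cat //.
  rewrite drop_size_cat // size_cat => H; apply/andP; apply: H; lia.
apply/allP => i; rewrite mem_iota => Hi.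
have [|||-> ->] // := Ht (take i t) (drop i t).
- by rewrite cat_take_drop.
- by rewrite neq_nil size_take; case: ifP; lia.
- by rewrite neq_nil size_drop; lia.
Qed.

Lemma cleanP s :
  reflect (forall u v t w, s = u ++ v -> v ++ u = t ++ w -> ~~ conflict t) (clean s).
Proof.
apply: (iffP allP) => [cl u v t w def_s def_t | cl k _].
  have le_t : (size t < (size s).+1)%N.
    have := congr1 size def_t; rewrite def_s !size_cat; lia.
  have le_u : (size u < (size s).+1)%N by rewrite def_s size_cat; lia.
  have := cl (size u); rewrite mem_iota => /(_ le_u) /allP/(_ (size t)).
  rewrite mem_iota => /(_ le_t).
  by rewrite {1}def_s rot_size_cat def_t take_size_cat.
apply/allP => l _; apply: (cl (take k s) (drop k s) _ (drop l (rot k s))).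
  by rewrite cat_take_drop.
by rewrite cat_take_drop.
Qed.

Lemma cat_eq_cat (T : Type) (u v t w : seq T) : u ++ v = t ++ w ->
  (exists z, u = t ++ z /\ w = z ++ v) \/ (exists z, t = u ++ z /\ v = z ++ w).
Proof.
elim: u t => [|e u IHu] [|e' t] /=; first by move=> ->; left; exists [::].
- by move=> ->; right; exists (e' :: t).
- by move=> <-; left; exists (e :: u).
case=> <- /IHu[] [z [-> ->]]; [left | right]; by exists z.
Qed.

Lemma clean_rot x y : clean (x ++ y) = clean (y ++ x).
Proof.
suff H: forall x y, clean (x ++ y) -> clean (y ++ x).
  by apply/idP/idP; apply: H.
move=> {}x {}y /cleanP cl; apply/cleanP => u v t w def_s def_t.
have [] := cat_eq_cat def_s => -[z [defz defv]].
  apply: (cl (x ++ u) z t w); first by rewrite defz catA.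
  by rewrite -def_t defv catA.
apply: (cl z (v ++ y) t w); first by rewrite defv catA.
by rewrite -def_t defz catA.
Qed.

Lemma conflict_head e t : conflict (e :: t) -> 0 < e.1.
Proof.
case/conflictP=> szt /(_ [:: e] t); rewrite sum1_cons sum1_nil addr0.
by case=> //; case: t szt.
Qed.

Lemma conflict_last t e : conflict (rcons t e) -> e.2 < 0.
Proof.
case/conflictP; rewrite size_rcons => szt /(_ t [:: e]).
rewrite sum2_cons sum2_nil addr0 cats1.
by case=> //; case: t szt.
Qed.

Lemma conflict_size t : conflict t -> (1 < size t)%N.
Proof. by case/conflictP. Qed.

(** The relative positions of a cyclic segment and of a block B: away from B,
    running through B, starting in B, and ending in B. *)
Lemma conflict_segment_block (B r u v t w : seq (int * int)) :
    B ++ r = u ++ v -> v ++ u = t ++ w -> conflict t ->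
  [\/ exists x y, r = x ++ t ++ y,
      exists r1 m r2, [/\ r = r1 ++ m ++ r2, t = r2 ++ B ++ r1, r1 != [::]
                        & r2 != [::]],
      exists B1 B2 w', [/\ B = B1 ++ B2, B2 != [::] & B2 ++ r ++ B1 = t ++ w']
    | exists B1 B2 t', [/\ B = B1 ++ B2, B1 != [::] & t = t' ++ B1]].
Proof.
move=> def_s def_t conf_t.
(* u contains B: the reading starts inside r or, if v is empty, at B. *)
have case1 z : u = B ++ z -> r = z ++ v ->
  [\/ exists x y, r = x ++ t ++ y,
      exists r1 m r2, [/\ r = r1 ++ m ++ r2, t = r2 ++ B ++ r1, r1 != [::]
                        & r2 != [::]],
      exists B1 B2 w', [/\ B = B1 ++ B2, B2 != [::] & B2 ++ r ++ B1 = t ++ w']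
    | exists B1 B2 t', [/\ B = B1 ++ B2, B1 != [::] & t = t' ++ B1]].
  move=> def_u def_r; rewrite def_u in def_t.
  have [] := cat_eq_cat def_t => -[z' [def1 def2]].
    by apply: Or41; exists z, z'; rewrite def_r def1.
  have [z'0 | z'n] := eqVneq z' [::].
    by apply: Or41; exists z, [::]; rewrite def_r def1 z'0 !cats0.
  have [] := cat_eq_cat def2 => -[z3 [def3 def4]].
    by apply: Or44; exists z', z3, v.
  have [B0 | Bn] := eqVneq B [::].
    rewrite B0 /= in def3; rewrite def3 in def1.
    have [v0 | vn] := eqVneq v [::].
      by apply: Or41; exists [::], w; rewrite def1 v0 def_r def4 v0 cats0.
    apply: Or42; exists z3, w, v; rewrite def_r def4 catA B0; split=> //.
    by rewrite -def3.
  have [z30 | z3n] := eqVneq z3 [::].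
    by apply: Or44; exists B, [::], v; rewrite cats0 def1 def3 z30 cats0.
  have [v0 | vn] := eqVneq v [::].
    apply: Or43; exists [::], B, w.
    by rewrite def1 v0 def3 def_r def4 v0 !cats0 catA.
  apply: Or42; exists z3, w, v; split=> //; first by rewrite def_r def4 catA.
  by rewrite def1 def3.
have [] := cat_eq_cat (esym def_s) => -[z [def1 def2]].
  exact: (case1 z).
have [z0 | zn] := eqVneq z [::].
  apply: (case1 [::]); first by rewrite def1 z0 !cats0.
  by rewrite def2 z0.
by apply: Or43; exists u, z, w; rewrite -def_t def2 -catA.
Qed.

Definition no_conflict_from B := forall B1 B2 v t w : seq (int * int),
  B = B1 ++ B2 -> B2 != [::] -> B2 ++ v = t ++ w -> ~~ conflict t.
Definition no_conflict_into B := forall B1 B2 t : seq (int * int),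
  B = B1 ++ B2 -> B1 != [::] -> ~~ conflict (t ++ B1).

(** When no conflict starts or ends in a block, only its effect on the conflicts
    that run through it matters. *)
Lemma clean_block B B' r :
    no_conflict_from B -> no_conflict_into B ->
    no_conflict_from B' -> no_conflict_into B' ->
    (forall r1 r2, r1 != [::] -> r2 != [::] ->
       conflict (r2 ++ B ++ r1) = conflict (r2 ++ B' ++ r1)) ->
  clean (B ++ r) = clean (B' ++ r).
Proof.
move=> sB eB sB' eB' cross.
suff H: forall B B', no_conflict_from B -> no_conflict_into B ->
  (forall r1 r2, r1 != [::] -> r2 != [::] ->
       conflict (r2 ++ B ++ r1) = conflict (r2 ++ B' ++ r1)) ->
  clean (B' ++ r) -> clean (B ++ r).
  by apply/idP/idP; apply: H => // r1 r2 n1 n2; rewrite cross.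
move=> {sB eB sB' eB' cross} {}B {}B' sB eB cross /cleanP cl.
apply/cleanP => u v t w def_s def_t; apply/negP => conf_t.
case: (conflict_segment_block def_s def_t conf_t).
- case=> x [y def_r]; move: conf_t; apply/negP.
  apply: (cl (B' ++ x) (t ++ y) t (y ++ B' ++ x)); first by rewrite def_r -!catA.
  by rewrite -!catA.
- case=> r1 [m [r2 [def_r def_t' n1 n2]]]; move: conf_t.
  rewrite def_t' cross //; apply/negP.
  apply: (cl (B' ++ r1 ++ m) r2 _ m); first by rewrite def_r -!catA.
  by rewrite -!catA.
- by case=> B1 [B2 [w' [defB B2n /(sB _ _ _ _ _ defB B2n)]]]; rewrite conf_t.
by case=> B1 [B2 [t' [defB B1n def]]]; move: conf_t; rewrite def (negPf (eB _ _ _ defB B1n)).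
Qed.

Definition prefix_nneg B := forall x y : seq (int * int), B = x ++ y -> 0 <= sum1 x /\ 0 <= sum2 x.

(** The cuts inside B impose no condition: since the prefixes of B have
    nonnegative sums, the first sum is at such a cut at least what it is at the
    start of B, and the second one, which is taken over what follows the cut, at
    most what it is there. *)
Lemma conflict_block B B' r1 r2 : r1 != [::] -> r2 != [::] ->
    sum1 B = sum1 B' -> sum2 B = sum2 B' -> prefix_nneg B -> prefix_nneg B' ->
  conflict (r2 ++ B ++ r1) = conflict (r2 ++ B' ++ r1).
Proof.
move=> n1 n2 eqf eqg pB pB'.
suff H: forall B B', sum1 B = sum1 B' -> sum2 B = sum2 B' -> prefix_nneg B ->
  conflict (r2 ++ B' ++ r1) -> conflict (r2 ++ B ++ r1).
  by apply/idP/idP; apply: H.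
move=> {eqf eqg pB pB'} {}B {}B' eqf eqg pB /conflictP[_ conflict']; apply/conflictP; split.
  by move: n1 n2; rewrite !neq_nil !size_cat; lia.
move=> t1 t2 def_t n1' n2'.
have [] := cat_eq_cat def_t => -[z [def1 def2]].
  have [|//||fz] := conflict' t1 (z ++ B' ++ r1); first by rewrite def1 catA.
    by move: n1; rewrite !neq_nil !size_cat; lia.
  by rewrite def2 !step_sumE eqg.
have [] := cat_eq_cat def2 => -[z' [def3 def4]]; last first.
  have [||//|] := conflict' (r2 ++ B' ++ z') t2.
  - by rewrite def4 -!catA.
  - by move: n2; rewrite !neq_nil !size_cat; lia.
  by rewrite def1 def3 !step_sumE eqf.
have [//|//||] := conflict' r2 (B' ++ r1).
  by move: n1; rewrite !neq_nil !size_cat; lia.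
have [] := pB _ _ def3.
rewrite def1 def4 !step_sumE -eqg def3 !step_sumE; lia.
Qed.

Lemma no_conflict_from1 e : e.1 <= 0 -> no_conflict_from [:: e].
Proof.
move=> e1 B1 [|e2 B2] v [|e3 t] w //= def _ [<- _].
apply/negP=> /conflict_head; have: e2 \in B1 ++ e2 :: B2 by rewrite mem_cat mem_head orbT.
by rewrite -def inE => /eqP->; rewrite ltNge e1.
Qed.

Lemma no_conflict_into1 e : 0 <= e.2 -> no_conflict_into [:: e].
Proof.
move=> e2 [|e' B1] B2 t //= -[<-]; case: B1 => // _ _.
by apply/negP; rewrite cats1 => /conflict_last; rewrite ltNge e2.
Qed.

Lemma prefix_nneg1 e : 0 <= e.1 -> 0 <= e.2 -> prefix_nneg [:: e].
Proof.
move=> e1 e2 [|e' x] y /=; rewrite ?step_sumE // => -[<-].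
by case: x => //; rewrite !step_sumE !addr0.
Qed.

(** A piece of path that only contributes its width k. *)
Definition step_mark (k : nat) : int * int := (0, k%:Z).
Definition step_open : int * int := (1, 0).
Definition step_close (beta : nat) : int * int := (-1, - beta%:Z).
Definition step_hor (c : nat) : int * int := (c%:Z, 1).

Lemma sum_marks ws : sum1 (map step_mark ws) = 0
  /\ sum2 (map step_mark ws) = (sumn ws)%:Z.
Proof.
by elim: ws => [|w ws [IHf IHg]] /=; rewrite !step_sumE //= IHf IHg add0r PoszD.
Qed.

(** An opening and a closing bracket with only marks between them form an
    innermost arc, which is selected if beta = b. The arc is a conflict if it is
    narrower than beta. Otherwise it can be contracted to a mark that remembers
    by how much it is wider than required; this width is nonnegative, which is
    what the arcs around it need. *)
Lemma clean_elim (beta : nat) ws r :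
  clean (step_open :: map step_mark ws ++ step_close beta :: r)
  = (beta <= sumn ws)%N && clean (step_mark (sumn ws - beta) :: r).
Proof.
set ms := map _ _.
have pre_ms x y : ms = x ++ y -> sum1 x = 0 /\ 0 <= sum2 x <= (sumn ws)%:Z.
  move=> def; have [k ->] : exists k, x = take k ms.
    by exists (size x); rewrite def take_size_cat.
  rewrite -map_take; have [-> ->] := sum_marks (take k ws); split=> //.
  have := congr1 sumn (cat_take_drop k ws); rewrite sumn_cat; lia.
have [fms gms] : sum1 ms = 0 /\ sum2 ms = (sumn ws)%:Z by apply: sum_marks.
set B := step_open :: ms ++ [:: step_close beta].
have -> : step_open :: ms ++ step_close beta :: r = B ++ r by rewrite /= -catA.
have [le_b | lt_b] /= := leqP beta (sumn ws); last first.
  apply/cleanP=> /(_ [::] (B ++ r) B r); rewrite cats0 => /(_ erefl erefl)/negP.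
  apply; apply/conflictP; split; first by rewrite /B /= size_cat /=; lia.
  move=> [|e x] y //= [<- def] _ yn; have [] := cat_eq_cat def => -[z [d1 d2]].
    have [fx gx] := pre_ms _ _ d1.
    rewrite step_sumE fx /= d2 !step_sumE /=; split=> //.
    have := gms; rewrite d1 !step_sumE; lia.
  case: z d1 d2 => [|e' [|//]]; last by case: y yn {def} => // ? ? _ _ [].
  rewrite cats0 /= => -> <-; rewrite !step_sumE fms /=; split=> //; lia.
(* beta <= sumn ws: all prefixes have nonnegative second sum, even with the closing bracket. *)
have pre_x x y : ms ++ [:: step_close beta] = x ++ y ->
    -1 <= sum1 x /\ 0 <= sum2 x.
  move=> def; have [] := cat_eq_cat def => -[z [d1 d2]].
    by have [-> /andP[-> _]] := pre_ms _ _ d1.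
  case: z d1 d2 => [|e' [|//]]; first by rewrite cats0 => -> _; rewrite fms gms.
  by case=> -> [<- _]; rewrite !step_sumE fms gms /=; split; lia.
have pB : prefix_nneg B.
  case=> [|e x] y /=; first by rewrite !step_sumE.
  by case=> <- /pre_x; rewrite !step_sumE /=; lia.
have val_other : sum1 B = 0 by rewrite /B !step_sumE fms.
have gB : sum2 B = (sumn ws - beta)%N%:Z by rewrite /B !step_sumE gms /=; lia.
have not_bad x y : B = x ++ y -> ~~ conflict x.
  case: x => [|e x] /= ; first by [].
  case=> <- /pre_x[_ gx]; apply/negP=> bx; have := conflict_size bx.
  case/conflictP: bx => _ /(_ [:: step_open] x erefl erefl) H /=.
  by case: x H gx => // e' x /(_ erefl)[_ ]; lia.
change (clean (B ++ r) = clean ([:: step_mark (sumn ws - beta)] ++ r)).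
apply: clean_block.
- case=> [|e B1] B2 v t w /= def B2n def2.
    rewrite -def in def2.
    have [] := cat_eq_cat def2 => -[z [d1 d2]]; first exact: not_bad d1.
    rewrite d1; have [z0|zn] := eqVneq z [::].
      by rewrite z0 cats0; apply: (@not_bad _ [::]); rewrite cats0.
    by apply/conflictP=> -[_ /(_ B z erefl isT zn)[]]; rewrite val_other.
  case: def => _ def; case: B2 B2n def def2 => // e2 B2 _ def.
  case: t => [|e3 t] /=; first by [].
  case=> <- _; apply/negP=> /conflict_head.
  have : e2 \in ms ++ [:: step_close beta] by rewrite def mem_cat mem_head orbT.
  rewrite mem_cat inE => /orP[/mapP[w' _ ->] // | /eqP-> //].
- move=> B1 B2 t def B1n; have [->|tn] := eqVneq t [::]; first exact: not_bad def.
  by apply/conflictP=> -[_ /(_ _ _ erefl tn B1n)]; have := pB _ _ def; lia.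
- exact: no_conflict_from1.
- exact: no_conflict_into1.
move=> r1 r2 n1 n2; apply: conflict_block => //; first by rewrite val_other !step_sumE.
  by rewrite gB !step_sumE addr0.
exact: prefix_nneg1.
Qed.

Lemma clean_cons0 r : clean (step_mark 0 :: r) = clean r.
Proof.
apply: (@clean_block [:: step_mark 0] [::]).
- exact: no_conflict_from1.
- exact: no_conflict_into1.
- by case=> // -[].
- by case.
move=> r1 r2 n1 n2; apply: conflict_block; rewrite ?step_sumE //; first exact: prefix_nneg1.
by case=> // y; rewrite !step_sumE.
Qed.

Lemma sum_opens c : sum1 (nseq c step_open) = c%:Z /\ sum2 (nseq c step_open) = 0.
Proof. by elim: c => [|c [IHf IHg]]; rewrite !step_sumE //= IHf IHg /=; split; lia. Qed.

Lemma cat_eq_nseq (T : eqType) (e : T) n x y :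
  nseq n e = x ++ y -> x = nseq (size x) e /\ y = nseq (size y) e.
Proof.
move=> def; have := all_pred1_nseq e n; rewrite def all_cat.
by case/andP=> /all_pred1P-> /all_pred1P->; rewrite !size_nseq.
Qed.

Lemma not_conflict_cat t z : z != [::] -> all (fun e => 0 <= e.2) z -> ~~ conflict (t ++ z).
Proof.
case/lastP: z => // z e _; rewrite all_rcons -rcons_cat => /andP[e2 _].
by apply/negP=> /conflict_last; rewrite ltNge e2.
Qed.

(** The conflicts that start with a selected horizontal edge are the conflicts
    that start with one of c opening brackets: the outermost bracket gives the
    weakest condition, and it is the same as for the edge. *)
Lemma clean_split (c : nat) r :
  clean (step_hor c :: r) = clean (step_mark 1 :: nseq c step_open ++ r).
Proof.
have [fc gc] := sum_opens c.
pose B' := step_mark 1 :: nseq c step_open.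
have all' : all (fun e => 0 <= e.2) B' by rewrite /= all_nseq orbT.
have pre' : prefix_nneg B'.
  case=> [|e x] y /=; first by rewrite !step_sumE.
  case=> <- /cat_eq_nseq[-> _]; have [fx gx] := sum_opens (size x).
  by rewrite !step_sumE fx gx.
have cross r1 r2 : r1 != [::] -> r2 != [::] ->
    conflict (r2 ++ [:: step_hor c] ++ r1) = conflict (r2 ++ B' ++ r1).
  move=> n1 n2; apply: conflict_block; rewrite // ?/B' ?step_sumE ?fc ?gc /= ?addr0 ?add0r //.
  exact: prefix_nneg1.
change (clean ([:: step_hor c] ++ r) = clean (B' ++ r)).
apply/cleanP/cleanP => cl u v t w def_s def_t; apply/negP => conf_t.
  case: (conflict_segment_block def_s def_t conf_t).
  - case=> x [y def_r]; move: conf_t; apply/negP.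
    apply: (cl (step_hor c :: x) (t ++ y) t (y ++ step_hor c :: x)); first by rewrite def_r.
    by rewrite -!catA.
  - case=> r1 [m [r2 [def_r def_t' n1 n2]]]; move: conf_t.
    rewrite def_t' -cross //; apply/negP.
    apply: (cl (step_hor c :: r1 ++ m) r2 _ m); first by rewrite def_r /= -!catA.
    by rewrite -!catA.
  - case=> B1 [B2 [w' [defB B2n def2]]].
    move: all'; rewrite defB all_cat => /andP[all1 all2].
    have t_n : t != [::] by rewrite neq_nil; have := conflict_size conf_t; lia.
    (* B2 consists of opening brackets of the block, and the conflict goes on in r. *)
    have [z [d1 zn [z' [d2 _]]]] : exists z, [/\ t = B2 ++ z, z != [::] &
        exists z', r = z ++ z' /\ w' = z' ++ B1].
      have [] := cat_eq_cat def2 => -[z [d1 d2]].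
        move: all2; rewrite d1 all_cat => /andP[allt _].
        by have := @not_conflict_cat [::] t t_n allt; rewrite conf_t.
      have [z0 | zn] := eqVneq z [::].
        by have := @not_conflict_cat [::] B2 B2n all2; rewrite /= -(cats0 B2) -z0 -d1 conf_t.
      exists z; split=> //.
      have [] := cat_eq_cat d2 => -[z' [d3 d4]]; first by exists z'.
      have [z'0 | z'n] := eqVneq z' [::].
        by exists [::]; rewrite cats0 d3 z'0 cats0 d4 z'0.
      move: all1; rewrite d4 all_cat => /andP[allz' _].
      by have := @not_conflict_cat (B2 ++ r) z' z'n allz'; rewrite -catA -d3 -d1 conf_t.
    case: B1 defB def2 all1 => [|e B1] /= defB _ _.
      by move: conf_t; rewrite d1 -defB /= => /conflict_head.
    case: defB => _ defB; have [_ def_B2] := cat_eq_nseq defB.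
    have le_c : (size B2 <= c)%N.
      by have := congr1 size defB; rewrite size_nseq size_cat; lia.
    have [f2 g2] := sum_opens (size B2); rewrite -def_B2 in f2 g2.
    have := cl [::] (step_hor c :: r) (step_hor c :: z) z' erefl.
    rewrite cats0 d2 => /(_ erefl)/negP; apply; apply/conflictP; split.
      by move: zn; rewrite neq_nil /=; lia.
    case=> [|e' x] y //= [<- def_z] _ yn; case/conflictP: conf_t => _ /(_ (B2 ++ x) y).
    rewrite d1 def_z catA => /(_ erefl); rewrite !step_sumE f2 /= => -[] //.
      by move: B2n; rewrite !neq_nil size_cat; lia.
    by move=> fx gy; split=> //; lia.
  by case=> B1 [B2 [t' [defB B1n def]]]; move: conf_t; rewrite def; apply/negP;
     apply: not_conflict_cat => //; move: all'; rewrite defB all_cat => /andP[].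
case: (conflict_segment_block def_s def_t conf_t).
- case=> x [y def_r]; move: conf_t; apply/negP.
  apply: (cl (B' ++ x) (t ++ y) t (y ++ B' ++ x)); first by rewrite def_r -!catA.
  by rewrite -!catA.
- case=> r1 [m [r2 [def_r def_t' n1 n2]]]; move: conf_t.
  rewrite def_t' cross //; apply/negP.
  apply: (cl (B' ++ r1 ++ m) r2 _ m); first by rewrite def_r -!catA.
  by rewrite -!catA.
- case=> B1 [B2 [w' [defB B2n def2]]].
  case: B1 defB def2 => [|e B1] /= defB; last by case: B1 defB => // -[_ def]; rewrite -def in B2n.
  rewrite -defB /= cats0; case: t conf_t {def_t} => [/conflict_size //|e t] conf_t [defe def_r].
  rewrite -defe in conf_t; have := conflict_head conf_t => /= c_gt0.
  have := cl [:: step_mark 1] (nseq c step_open ++ r) (nseq c step_open ++ t)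
    (w' ++ [:: step_mark 1]) erefl.
  rewrite def_r -!catA => /(_ erefl)/negP; apply.
  have t_n : t != [::] by rewrite neq_nil; have := conflict_size conf_t => /=; lia.
  case/conflictP: conf_t => _ conf_t; apply/conflictP; split.
    by move: t_n; rewrite size_cat size_nseq neq_nil; lia.
  move=> t1 t2 def12 n1 n2.
  have [] := cat_eq_cat def12 => -[z [d1 d2]].
    have [d3 d4] := cat_eq_nseq d1.
    have [f1 g1] := sum_opens (size t1); have [f4 g4] := sum_opens (size z).
    rewrite -d3 in f1 g1; rewrite -d4 in f4 g4.
    have [//|//|//|_ gt] := conf_t [:: step_hor c] t.
    rewrite d2 !step_sumE g4 f1; split; last by rewrite add0r.
    by move: n1; rewrite neq_nil; lia.
  have [|//|//|] := conf_t (step_hor c :: z) t2; first by rewrite d2.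
  by rewrite d1 !step_sumE fc.
case=> B1 [B2 [t' [defB B1n def]]]; move: conf_t; rewrite def; apply/negP.
apply: (@no_conflict_into1 (step_hor c)) => //; exact: defB.
Qed.

Lemma not_conflict_nneg s : all (fun e => 0 <= e.2) s -> ~~ conflict s.
Proof.
move=> s_nneg; have [-> | s_n] := eqVneq s [::] => //.
exact: (@not_conflict_cat [::]).
Qed.

Lemma clean_nneg s : all (fun e => 0 <= e.2) s -> clean s.
Proof.
move=> s_nneg; apply/cleanP => u v t w def_s def_t; apply: not_conflict_nneg.
have : all (fun e : int * int => 0 <= e.2) (v ++ u).
  by rewrite all_cat andbC -all_cat -def_s.
by rewrite def_t all_cat => /andP[].
Qed.

Lemma clean_npos s : all (fun e => e.1 <= 0) s -> clean s.
Proof.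
move=> s_npos; apply/cleanP => u v [//|e t] w def_s def_t.
have : all (fun e : int * int => e.1 <= 0) (v ++ u).
  by rewrite all_cat andbC -all_cat -def_s.
by rewrite def_t /= => /andP[e1 _]; apply/negP=> /conflict_head; rewrite ltNge e1.
Qed.

Definition dual_step (e : int * int) : int * int := (- e.2, - e.1).

Lemma dual_stepK : involutive dual_step.
Proof. by case=> f g; rewrite /dual_step /= !opprK. Qed.

Lemma dual_sum s : sum1 (rev (map dual_step s)) = - sum2 s
  /\ sum2 (rev (map dual_step s)) = - sum1 s.
Proof.
elim: s => [|e s [IHf IHg]]; first by rewrite !step_sumE oppr0.
rewrite /= rev_cons -cats1 !step_sumE IHf IHg /= !addr0 -!opprD.
by rewrite [sum2 s + _]addrC [sum1 s + _]addrC.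
Qed.

Lemma conflict_dual s : conflict (rev (map dual_step s)) = conflict s.
Proof.
suff H t : conflict t -> conflict (rev (map dual_step t)).
  apply/idP/idP => [/H|]; last exact: H.
  by rewrite -map_rev revK -map_comp (eq_map dual_stepK) map_id.
case/conflictP=> szt bt; apply/conflictP; split; first by rewrite size_rev size_map.
move=> t1 t2 def n1 n2.
have def_t : t = rev (map dual_step t2) ++ rev (map dual_step t1).
  by rewrite -rev_cat -map_cat -def map_rev revK -map_comp (eq_map dual_stepK) map_id.
have [||ft gt] := bt _ _ def_t; rewrite ?neq_nil ?size_rev ?size_map -?neq_nil //.
move: ft gt; rewrite (dual_sum t2).1 (dual_sum t1).2.
by rewrite oppr_gt0 oppr_lt0.
Qed.

Lemma clean_dual s : clean (rev (map dual_step s)) = clean s.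
Proof.
suff H t : clean t -> clean (rev (map dual_step t)).
  apply/idP/idP => [/H|]; last exact: H.
  by rewrite -map_rev revK -map_comp (eq_map dual_stepK) map_id.
move=> cl; apply/cleanP => u v t' w def_s def_t.
pose d := fun s => rev (map dual_step s).
have dK s' : d (d s') = s' by rewrite /d -map_rev revK -map_comp (eq_map dual_stepK) map_id.
have dcat s1 s2 : d (s1 ++ s2) = d s2 ++ d s1 by rewrite /d map_cat rev_cat.
rewrite -conflict_dual -/(d t').
have : clean (d t' ++ d w).
  by rewrite clean_rot -dcat -def_t dcat clean_rot -dcat -def_s -/(d t) dK.
by move/cleanP=> /(_ [::] (d t' ++ d w) (d t') (d w) erefl); rewrite cats0 => /(_ erefl).
Qed.

(** * Duality for cyclic words of brackets *)

(** Op is an opening bracket, Cl a closing bracket which may be selected or not,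
    and Mk k a mark of width k. *)
Definition letter := (bool + nat)%type.
Local Notation Op := (inl true : letter).
Local Notation Cl := (inl false : letter).
Local Notation Mk := (inr : nat -> letter).

Section SlotSum.
Variables (R : comNzRingType) (b : nat) (z : R).
Implicit Types (W : seq letter) (Q : seq (int * int) -> R).

(** The sum, over the choices of selected closing brackets, of a power of z
    counting them times the value of Q at the resulting word of steps. With Q as
    a continuation, a concatenation of words becomes a nesting of sums. *)
Fixpoint slotsum W Q : R :=
  match W with
  | [::] => Q [::]
  | inl true :: W' => slotsum W' (fun s => Q (step_open :: s))
  | inl false :: W' => slotsum W' (fun s => Q (step_close 0 :: s))
                        + z * slotsum W' (fun s => Q (step_close b :: s))
  | inr k :: W' => slotsum W' (fun s => Q (step_mark k :: s))
  end.

Lemma eq_slotsum W Q Q' : Q =1 Q' -> slotsum W Q = slotsum W Q'.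
Proof.
elim: W Q Q' => [|[[]|k] W IH] Q Q' eqQ /=; first exact: eqQ.
- by apply: IH => s; apply: eqQ.
- by congr (_ + z * _); apply: IH => s; apply: eqQ.
by apply: IH => s; apply: eqQ.
Qed.

Lemma slotsum_cat W1 W2 Q :
  slotsum (W1 ++ W2) Q = slotsum W1 (fun s => slotsum W2 (fun t => Q (s ++ t))).
Proof.
elim: W1 Q => [|[[]|k] W1 IH] Q //=; by rewrite !IH.
Qed.

Lemma slotsumZ a W Q : slotsum W (fun s => a * Q s) = a * slotsum W Q.
Proof.
elim: W Q => [|[[]|k] W IH] Q //=; rewrite !IH // mulrDr; congr (_ + _).
by rewrite mulrCA.
Qed.

Lemma slotsumD W Q1 Q2 :
  slotsum W (fun s => Q1 s + Q2 s) = slotsum W Q1 + slotsum W Q2.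
Proof.
elim: W Q1 Q2 => [|[[]|k] W IH] Q1 Q2 //=; rewrite !IH // mulrDr.
by rewrite addrACA.
Qed.

Lemma slotsum_exchange W1 W2 (Q : seq (int * int) -> seq (int * int) -> R) :
  slotsum W1 (fun s => slotsum W2 (Q s))
    = slotsum W2 (fun t => slotsum W1 (fun s => Q s t)).
Proof.
elim: W1 Q => [|[[]|k] W1 IH] Q //=; rewrite !IH // -slotsumZ -slotsumD.
exact: eq_slotsum.
Qed.

Lemma slotsum_marks ws W Q :
  slotsum (map Mk ws ++ W) Q = slotsum W (fun s => Q (map step_mark ws ++ s)).
Proof. by elim: ws Q => [|w ws IH] Q //=; rewrite IH. Qed.

Lemma slotsum_opens n W Q :
  slotsum (nseq n Op ++ W) Q = slotsum W (fun s => Q (nseq n step_open ++ s)).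
Proof. by elim: n Q => [|n IH] Q //=; rewrite IH. Qed.

Definition num_open W := count (pred1 Op) W.
Definition num_close W := count (pred1 Cl) W.

Definition flip_letter (l : letter) : letter := if l is inl x then inl (~~ x) else l.
(** Read backwards, an opening bracket becomes a closing one. *)
Definition dual_letters W := rev (map flip_letter W).

Lemma dual_cat W1 W2 : dual_letters (W1 ++ W2) = dual_letters W2 ++ dual_letters W1.
Proof. by rewrite /dual_letters map_cat rev_cat. Qed.

Lemma num_open_dual W : num_open (dual_letters W) = num_close W.
Proof.
rewrite /num_open /dual_letters count_rev count_map; apply: eq_count.
by case=> [[]|k].
Qed.

Lemma num_close_dual W : num_close (dual_letters W) = num_open W.
Proof.
rewrite /num_close /dual_letters count_rev count_map; apply: eq_count.
by case=> [[]|k].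
Qed.

Definition clean_sum W := slotsum W (fun s => (clean s)%:R).

Lemma clean_sum_rot W1 W2 : clean_sum (W1 ++ W2) = clean_sum (W2 ++ W1).
Proof.
rewrite /clean_sum !slotsum_cat slotsum_exchange; apply: eq_slotsum => s.
by apply: eq_slotsum => t; rewrite clean_rot.
Qed.

Lemma clean_sum_elim ws W :
  clean_sum (Op :: map Mk ws ++ Cl :: W) =
    clean_sum (Mk (sumn ws) :: W)
    + (b <= sumn ws)%N%:R * z * clean_sum (Mk (sumn ws - b)%N :: W).
Proof.
rewrite /clean_sum /= slotsum_marks /=; congr (_ + _).
  by apply: eq_slotsum => s; rewrite clean_elim subn0.
rewrite -mulrA mulrCA; congr (_ * _); rewrite -slotsumZ.
by apply: eq_slotsum => s; rewrite clean_elim -natrM mulnb andbC.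
Qed.

Lemma slotsum_no_close W Q : num_close W = 0%N ->
  exists2 s, all (fun e : int * int => 0 <= e.2) s & slotsum W Q = Q s.
Proof.
elim: W Q => [|[[]|k] W IH] Q //=; first by exists [::].
  by move/(IH (fun s => Q (step_open :: s)))=> [s nn ->]; exists (step_open :: s).
by move/(IH (fun s => Q (step_mark k :: s)))=> [s nn ->]; exists (step_mark k :: s).
Qed.

Lemma slotsum_no_open W Q : num_open W = 0%N ->
    (forall s, all (fun e : int * int => e.1 <= 0) s -> Q s = 1) ->
  slotsum W Q = (1 + z) ^+ num_close W.
Proof.
rewrite /num_open /num_close.
elim: W Q => [|[[]|k] W IH] Q //=; first by move=> _ ->.
  move=> nW Q1; rewrite !IH //; first by rewrite exprS mulrDl mul1r.
  - by move=> s ns; apply: Q1; rewrite /= ns.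
  by move=> s ns; apply: Q1; rewrite /= ns.
by move=> nW Q1; rewrite IH // => s ns; apply: Q1; rewrite /= ns.
Qed.

Lemma clean_sum_no_close W : num_close W = 0%N -> clean_sum W = 1.
Proof.
move/(slotsum_no_close (fun s => (clean s)%:R))=> [s nn].
by rewrite /clean_sum => ->; rewrite clean_nneg.
Qed.

Lemma clean_sum_no_open W :
  num_open W = 0%N -> clean_sum W = (1 + z) ^+ num_close W.
Proof. by move=> nW; apply: slotsum_no_open => // s /clean_npos->. Qed.

(** The last opening bracket before a closing one starts an innermost arc. *)
Lemma adjacent_pair W : num_open W != 0%N -> num_close W != 0%N ->
  exists x y ws W', W = x ++ y /\ y ++ x = Op :: map Mk ws ++ Cl :: W'.
Proof.
rewrite -!lt0n -!has_count => /hasP[o oW /eqP def_o].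
have [x y] := splitPr oW; rewrite {}def_o => hasc.
(* Rotate the word so that it starts with an opening bracket. *)
suff [x' [y' [ws [W' [d1 d2]]]]] : exists x' y' ws W',
    (Op :: y) ++ x = x' ++ y' /\ y' ++ x' = Op :: map Mk ws ++ Cl :: W'.
  have [] := cat_eq_cat d1 => -[u [d3 d4]].
    exists (x ++ x'), u, ws, W'; split; first by rewrite d3 catA.
    by rewrite -d2 d4 catA.
  exists u, (y' ++ Op :: y), ws, W'; split; first by rewrite d4 catA.
  by rewrite -catA -d3 d2.
have {}hasc : has (pred1 Cl) (y ++ x) by move: hasc; rewrite !has_cat /= orbC.
rewrite cat_cons; move: (y ++ x) hasc => {x y oW W o} r.
case/split_find=> c x y /eqP-> no_cl.
(* x is the part before the first closing bracket; cut it at its last opening bracket. *)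
have [ws [x1 def_x]] : exists ws x1, Op :: x = x1 ++ Op :: map Mk ws.
  elim/last_ind: x no_cl => [_|x l IHx]; first by exists [::], [::].
  rewrite has_rcons negb_or => /andP[l_c /IHx[ws [x1 def_x]]].
  case: l l_c => [[]|k] // _.
    by exists [::], (Op :: x); rewrite -cats1.
  exists (rcons ws k), x1; rewrite map_rcons -!cats1.
  by change ((Op :: x) ++ [:: Mk k] = x1 ++ (Op :: map Mk ws) ++ [:: Mk k]);
     rewrite def_x -catA.
exists x1, (Op :: map Mk ws ++ Cl :: y), ws, (y ++ x1); split; last by rewrite /= -catA.
by change ((rcons (Op :: x) Cl) ++ y = x1 ++ (Op :: map Mk ws) ++ Cl :: y);
   rewrite def_x cat_rcons -catA.
Qed.

(** The unmatched closing brackets can be selected freely, and whether a set of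
    arcs can be selected does not depend on the direction of reading. So W and
    its dual differ only by their unmatched brackets, all of which are closing
    or all of which are opening. The induction contracts an innermost arc, once
    as an arc which is not selected and once as a selected one. *)
Theorem clean_sum_dual W :
  (1 + z) ^+ (num_open W - num_close W) * clean_sum W
  = (1 + z) ^+ (num_close W - num_open W) * clean_sum (dual_letters W).
Proof.
have [n] := ubnP (size W); elim: n W => // n IHn W ltWn.
have [o0 | o_n] := eqVneq (num_open W) 0%N.
  rewrite o0 sub0n subn0 expr0 mul1r (clean_sum_no_close (W := dual_letters W)).
    by rewrite mulr1 clean_sum_no_open.
  by rewrite num_close_dual.
have [c0 | c_n] := eqVneq (num_close W) 0%N.
  rewrite c0 sub0n subn0 expr0 mul1r (clean_sum_no_open (W := dual_letters W)).
    by rewrite clean_sum_no_close // mulr1 num_close_dual.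
  by rewrite num_open_dual.
have [x [y [ws [W' [defW def']]]]] := adjacent_pair o_n c_n.
have -> : clean_sum W = clean_sum (y ++ x) by rewrite defW clean_sum_rot.
have -> : clean_sum (dual_letters W) = clean_sum (dual_letters (y ++ x)).
  by rewrite defW !dual_cat clean_sum_rot.
have no_E : num_open W = (num_open W').+1.
  rewrite defW /num_open count_cat addnC -count_cat def' /= count_cat /= count_map.
  by rewrite (eq_count (a2 := pred0)) // count_pred0.
have nc_E : num_close W = (num_close W').+1.
  rewrite defW /num_close count_cat addnC -count_cat def' /= count_cat /= count_map.
  by rewrite (eq_count (a2 := pred0)) // count_pred0.
have szW : (size W = size ws + size W' + 2)%N.
  by rewrite defW size_cat addnC -size_cat def' /= size_cat /= size_map; lia.
have dual_mk k : clean_sum (dual_letters (Mk k :: W')) = clean_sum (Mk k :: dual_letters W').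
  by rewrite -cat1s dual_cat clean_sum_rot.
have IH k : (1 + z) ^+ (num_open W' - num_close W') * clean_sum (Mk k :: W')
  = (1 + z) ^+ (num_close W' - num_open W') * clean_sum (Mk k :: dual_letters W').
  by rewrite -dual_mk; apply: (IHn (Mk k :: W')) => /=; lia.
have -> : clean_sum (dual_letters (y ++ x)) =
          clean_sum (Op :: map Mk (rev ws) ++ Cl :: dual_letters W').
  rewrite def' -cat1s dual_cat -cat1s !dual_cat -!catA clean_sum_rot /dual_letters /=.
  by rewrite -catA -map_comp map_rev.
(* Contract the arc on both sides: it has one bracket of each kind. *)
rewrite def' !clean_sum_elim sumn_rev no_E nc_E !subSS !mulrDr IH; congr (_ + _).
by rewrite !(mulrCA _ (_ * z)) IH.
Qed.
End SlotSum.

(** * Sums over the selections of edges of a path *)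

(** No mark lies inside this arc, so selecting it is a conflict when b > 0. *)
Lemma clean_sum_cancel (R : comNzRingType) (b : nat) (z : R) x y : (0 < b)%N ->
  clean_sum b z (x ++ Op :: Cl :: y) = clean_sum b z (x ++ y).
Proof.
move=> b_gt0; rewrite clean_sum_rot cat_cons (clean_sum_elim b z [::] (y ++ x)).
rewrite leqn0 eqn0Ngt b_gt0 !mul0r addr0 [RHS]clean_sum_rot.
rewrite /clean_sum /=; apply: eq_slotsum => s; by rewrite clean_cons0.
Qed.

Lemma dual_clean_sum_cancel (R : comNzRingType) (b : nat) (z : R) x y : (0 < b)%N ->
  clean_sum b z (dual_letters (x ++ Op :: Cl :: y)) = clean_sum b z (dual_letters (x ++ y)).
Proof.
move=> b_gt0; rewrite -[Op :: Cl :: y]/([:: Op; Cl] ++ y) !dual_cat -catA.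
exact: clean_sum_cancel.
Qed.

Definition cancels (T : Type) (E : seq letter -> T) :=
  forall x y, E (x ++ Op :: Cl :: y) = E (x ++ y).

Lemma cancels_nseq (T : Type) (E : seq letter -> T) m n x y : cancels E ->
  E (x ++ nseq m Op ++ nseq n Cl ++ y)
  = E (x ++ nseq (m - n) Op ++ nseq (n - m) Cl ++ y).
Proof.
move=> cE; elim: m n => [|m IH] [|n] //; rewrite !subSS -IH.
have -> : nseq m.+1 Op ++ nseq n.+1 Cl ++ y = nseq m Op ++ Op :: Cl :: nseq n Cl ++ y.
  by elim: m {IH} => //= m ->.
by rewrite catA cE -catA.
Qed.

Lemma slotsum_sum (R : comNzRingType) (b : nat) (z : R) (I : Type) (r : seq I)
    (a : I -> R) (Q : I -> seq (int * int) -> R) W :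
  slotsum b z W (fun s => \sum_(i <- r) a i * Q i s)
  = \sum_(i <- r) a i * slotsum b z W (Q i).
Proof.
elim: r => [|i r IH].
  rewrite big_nil -[RHS](mul0r (slotsum b z W (fun=> 0))) -slotsumZ.
  by apply: eq_slotsum => s; rewrite big_nil mul0r.
rewrite big_cons -IH -slotsumZ -slotsumD.
by apply: eq_slotsum => s; rewrite big_cons.
Qed.

Fixpoint masks n : seq bitseq :=
  if n is n'.+1 then map (cons false) (masks n') ++ map (cons true) (masks n')
  else [:: [::]].

Lemma masksS n :
  masks n.+1 = map (cons false) (masks n) ++ map (cons true) (masks n).
Proof. by []. Qed.

Lemma mem_masks n m : (m \in masks n) = (size m == n).
Proof.
elim: n m => [|n IH] [|x m]; rewrite ?masksS ?mem_cat //.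
  by apply/orP=> -[] /mapP[].
have nin y : (x :: m \in map (cons y) (masks n)) = (x == y) && (size m == n).
  have [->|xy] := eqVneq x y; first by rewrite mem_map ?IH // => ? ? [].
  by apply/mapP=> -[m' _ [/eqP]]; rewrite (negPf xy).
by rewrite !nin eqSS; case: x {nin}; rewrite ?orbF.
Qed.

Lemma uniq_masks n : uniq (masks n).
Proof.
elim: n => //= n IH; rewrite cat_uniq !map_inj_uniq ?IH ?andbT //=; try by move=> ? ? [].
by apply/hasPn=> _ /mapP[m _ ->]; apply/mapP=> -[].
Qed.

Lemma perm_masks n (f : bitseq -> bitseq) : injective f ->
  (forall m, size (f m) = size m) -> perm_eq (map f (masks n)) (masks n).
Proof.
move=> f_inj f_size; have uf : uniq (map f (masks n)).
  by rewrite map_inj_uniq // uniq_masks.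
have sub : {subset map f (masks n) <= masks n}.
  by move=> m /mapP[m' + ->]; rewrite !mem_masks f_size.
apply: uniq_perm (uniq_masks n) _ => //.
by have [|_ eqi] := uniq_min_size uf sub; rewrite ?size_map.
Qed.

Section EdgeSum.
Variables (R : comNzRingType).
Implicit Types (w : bitseq) (Q : seq (int * int) -> R).

Definition edge_step (c b : nat) (h sel : bool) : int * int :=
  if h then if sel then step_hor c else step_mark 1
  else step_close (if sel then b else 0).

(** The analogue of slotsum for the words of a path, where both kinds of edges
    may be selected; wt h sel is the weight of an edge, which is horizontal if h
    and selected if sel. *)
Fixpoint edgesum (c b : nat) (wt : bool -> bool -> R) w Q : R :=
  if w is h :: w' then
    wt h false * edgesum c b wt w' (fun s => Q (edge_step c b h false :: s))
    + wt h true * edgesum c b wt w' (fun s => Q (edge_step c b h true :: s))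
  else Q [::].

Lemma eq_edgesum c b wt w Q Q' : Q =1 Q' -> edgesum c b wt w Q = edgesum c b wt w Q'.
Proof.
elim: w Q Q' => [|h w IH] Q Q' eqQ /=; first exact: eqQ.
by congr (_ * _ + _ * _); apply: IH => s; apply: eqQ.
Qed.

Lemma edgesum_cat c b wt w1 w2 Q :
  edgesum c b wt (w1 ++ w2) Q
  = edgesum c b wt w1 (fun s => edgesum c b wt w2 (fun t => Q (s ++ t))).
Proof. by elim: w1 Q => [|h w1 IH] Q //=; rewrite !IH. Qed.

Lemma edgesumZ c b wt w a Q :
  edgesum c b wt w (fun s => a * Q s) = a * edgesum c b wt w Q.
Proof.
by elim: w Q => [|h w IH] Q //=; rewrite !IH mulrDr !(mulrCA a).
Qed.

Lemma edgesumD c b wt w Q1 Q2 :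
  edgesum c b wt w (fun s => Q1 s + Q2 s)
  = edgesum c b wt w Q1 + edgesum c b wt w Q2.
Proof.
by elim: w Q1 Q2 => [|h w IH] Q1 Q2 //=; rewrite !IH !mulrDr addrACA.
Qed.

Lemma edgesum_scale c b wt wt' (k : bool -> R) w Q :
  (forall h s, wt h s = k h * wt' h s) ->
  edgesum c b wt w Q
  = k true ^+ count id w * k false ^+ count negb w * edgesum c b wt' w Q.
Proof.
move=> wtE; elim: w Q => [|h w IH] Q /=; first by rewrite !expr0 !mul1r.
rewrite !IH !wtE !exprD; case: h => /=; rewrite expr1 expr0; ring.
Qed.

Lemma edgesum_dual c b wt w Q :
  edgesum c b wt w Q
  = edgesum b c (fun h => wt (~~ h)) (rev (map negb w))
      (fun s => Q (rev (map dual_step s))).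
Proof.
have dE h sel : dual_step (edge_step b c (~~ h) sel) = edge_step c b h sel.
  by case: h sel => [] []; rewrite /edge_step /= /dual_step /step_close /step_hor /= ?opprK.
elim: w Q => [|h w IH] Q //=; rewrite rev_cons -cats1 edgesum_cat /= !IH negbK.
rewrite -!edgesumZ -edgesumD; apply: eq_edgesum => s.
by rewrite !map_cat !rev_cat /= !dE.
Qed.

Definition path_sum c b wt w := edgesum c b wt w (fun s => (clean s)%:R).

(** Reversing the path exchanges the two conditions in the definition of
    compatibility. *)
Lemma path_sum_dual c b wt w :
  path_sum c b wt w = path_sum b c (fun h => wt (~~ h)) (rev (map negb w)).
Proof.
by rewrite /path_sum edgesum_dual; apply: eq_edgesum => s; rewrite clean_dual.
Qed.

(** A horizontal edge, selected or not, followed by the vertical edges above its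
    right endpoint. *)
Definition column_letters c (p : bool * nat) : seq letter :=
  Mk 1 :: (if p.1 then nseq c Op else [::]) ++ nseq p.2 Cl.

Definition masked_letters c m hs : seq letter :=
  flatten (map (column_letters c) (zip m hs)).

Lemma edgesum_ver c b wt h w Q : wt false false = 1 ->
  edgesum c b wt (nseq h false ++ w) Q
  = slotsum b (wt false true) (nseq h Cl) (fun s => edgesum c b wt w (fun t => Q (s ++ t))).
Proof. by move=> wt1; elim: h Q => [|h IH] Q //=; rewrite !IH wt1 mul1r. Qed.

(** After clean_split, the selection m of the horizontal edges can be fixed and
    the remaining sum is one over a word of brackets. *)
Lemma edgesum_columns c b wt hs Q : wt false false = 1 ->
    (forall x y, Q (x ++ step_hor c :: y)
                 = Q (x ++ step_mark 1 :: nseq c step_open ++ y)) ->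
  edgesum c b wt (column_word hs) Q
  = \sum_(m <- masks (size hs))
      wt true false ^+ count negb m * wt true true ^+ count id m
        * slotsum b (wt false true) (masked_letters c m hs) Q.
Proof.
move=> wt1; elim: hs Q => [|h hs IH] Q QE /=; first by rewrite big_seq1 !expr0 !mul1r.
have colE Q' : (forall x y, Q' (x ++ step_hor c :: y)
                 = Q' (x ++ step_mark 1 :: nseq c step_open ++ y)) ->
   edgesum c b wt (nseq h false ++ column_word hs) Q' =
    \sum_(m <- masks (size hs)) wt true false ^+ count negb m * wt true true ^+ count id m *
     slotsum b (wt false true) (nseq h Cl ++ masked_letters c m hs) Q'.
  move=> QE'; rewrite edgesum_ver //.
  rewrite (eq_slotsum _ _ _ (Q' := fun s => \sum_(m <- masks (size hs))
      wt true false ^+ count negb m * wt true true ^+ count id m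
      * slotsum b (wt false true) (masked_letters c m hs) (fun t => Q' (s ++ t)))).
    by rewrite slotsum_sum; apply: eq_bigr => m _; rewrite slotsum_cat.
  by move=> s; rewrite IH // => x y; rewrite catA QE' -catA.
rewrite big_cat !big_map /= !colE; first last.
- by move=> x y; exact: (QE (_ :: x)).
- by move=> x y; exact: (QE (_ :: x)).
rewrite !mulr_sumr; congr (_ + _); apply: eq_bigr => m _.
  by rewrite !mulrA -exprS add0n add1n.
rewrite /edge_step add0n add1n exprS mulrCA !mulrA; congr (_ * _).
  by rewrite mulrAC.
rewrite /masked_letters /= -!catA slotsum_opens.
by apply: eq_slotsum => s; rewrite (QE [::]).
Qed.
End EdgeSum.

(** A column after cancellation of its brackets; its height is at most c. *)
Definition column_core c (p : bool * nat) : seq letter :=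
  Mk 1 :: if p.1 then nseq (c - p.2) Op else nseq p.2 Cl.

Definition core_letters c m hs := flatten (map (column_core c) (zip m hs)).

Lemma cancels_core (T : Type) (E : seq letter -> T) c x m hs : cancels E ->
    all (fun h => (h <= c)%N) hs ->
  E (x ++ masked_letters c m hs) = E (x ++ core_letters c m hs).
Proof.
move=> cE; elim: hs m x => [|h hs IH] [|s m] x //= /andP[le_h le_hs].
have -> : E (x ++ masked_letters c (s :: m) (h :: hs))
          = E (x ++ column_core c (s, h) ++ masked_letters c m hs).
  case: s => //; rewrite /masked_letters /= /column_letters /column_core /= -!catA.
  rewrite -!cat_rcons (cancels_nseq _ _ _ _ cE).
  by move/eqP: le_h => ->.
by rewrite catA IH // -catA.
Qed.

(** A column of height h with a selected edge keeps c - h opening brackets, and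
    one with an edge that is not selected keeps h closing ones. Taking
    complements of the selection and of the heights exchanges the two cases. *)
Lemma dual_core_letters c m hs : size m = size hs -> all (fun h => (h <= c)%N) hs ->
  Mk 1 :: dual_letters (core_letters c m hs)
  = core_letters c (rev (map negb m)) (rev (map (subn c) hs)) ++ [:: Mk 1].
Proof.
elim: hs m => [|h hs IH] [|s m] // [szm]; rewrite [all _ _]/= => /andP[le_h le_hs].
have -> : core_letters c (s :: m) (h :: hs) = column_core c (s, h) ++ core_letters c m hs.
  by [].
rewrite dual_cat -cat_cons IH // /core_letters /= !rev_cons zip_rcons ?size_rev ?size_map //.
rewrite map_rcons flatten_rcons -!catA; congr (_ ++ _).
rewrite /= /dual_letters /= rev_cons -cats1; congr (_ :: _ ++ _).
case: s; rewrite /= ?subKn // map_nseq /=; exact: rev_nseq.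
Qed.

Lemma clean_sum_complement (R : comNzRingType) (b c : nat) (z : R) m hs :
    (0 < b)%N -> size m = size hs -> all (fun h => (h <= c)%N) hs ->
  clean_sum b z (dual_letters (masked_letters c m hs))
  = clean_sum b z (masked_letters c (rev (map negb m)) (rev (map (subn c) hs))).
Proof.
move=> b_gt0 szm le_hs.
have cE : cancels (clean_sum b z) by move=> x y; apply: clean_sum_cancel.
have dcE : cancels (fun W => clean_sum b z (dual_letters W)).
  by move=> x y; apply: dual_clean_sum_cancel.
rewrite (cancels_core [::] m dcE) // (cancels_core [::] _ cE) /=; last first.
  by rewrite all_rev all_map; apply/allP=> h _ /=; apply: leq_subr.
(* The two words of cores are rotations of each other by one mark. *)
have := dual_core_letters szm le_hs.
case: (core_letters c (rev _) _) => [[->] // | l W [<- ->]].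
by rewrite clean_sum_rot.
Qed.

Lemma num_masked_letters c m hs : size m = size hs ->
  num_open (masked_letters c m hs) = (c * count id m)%N
  /\ num_close (masked_letters c m hs) = sumn hs.
Proof.
rewrite /num_open /num_close /masked_letters.
elim: hs m => [|h hs IH] [|s m] //=; first by rewrite muln0.
case=> /IH[IHo IHc]; rewrite !count_cat IHo IHc !count_nseq /= !mul1n.
by case: s; rewrite /= ?count_nseq /=; lia.
Qed.

Lemma clean_sum_masked (R : comNzRingType) (b c : nat) (z : R) m hs :
    (0 < b)%N -> size m = size hs -> all (fun h => (h <= c)%N) hs ->
  (1 + z) ^+ (c * size hs - sumn hs) * clean_sum b z (masked_letters c m hs)
  = (1 + z) ^+ (c * count negb m)
    * clean_sum b z (masked_letters c (rev (map negb m)) (rev (map (subn c) hs))).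
Proof.
move=> b_gt0 szm le_hs.
have [nO nC] := num_masked_letters c szm.
have := clean_sum_dual b z (masked_letters c m hs).
rewrite clean_sum_complement // nO nC.
have sz_count : (count id m + count negb m = size hs)%N.
  by rewrite -szm -(count_predC id m).
have le_sum : (sumn hs <= c * size hs)%N.
  elim: hs le_hs {szm nO nC sz_count} => [|h hs IH] /=; first by rewrite muln0.
  by move=> /andP[? /IH]; lia.
have [le_A | /ltnW le_A] := leqP (c * count id m) (sumn hs).
  move/eqP: (le_A) => ->; rewrite mul1r => ->; rewrite mulrA -exprD; congr (_ ^+ _ * _).
  nia.
move/eqP: (le_A) => ->; rewrite mul1r => <-; rewrite mulrA -exprD; congr (_ ^+ _ * _).
nia.
Qed.

(** The sums for the two paths are compared for each selection of horizontal
    edges separately; the complementary selection is used on the second path,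
    whence the exchange of the two weights of horizontal edges. The power of
    1 + z stands for the unmatched brackets. *)
Theorem path_sum_complement (R : comNzRingType) (b c : nat)
    (wt wt' : bool -> bool -> R) hs :
    (0 < b)%N -> all (fun h => (h <= c)%N) hs ->
    wt false false = 1 -> wt' false false = 1 -> wt' false true = wt false true ->
    wt' true false = wt true true ->
    wt' true true = wt true false * (1 + wt false true) ^+ c ->
  (1 + wt false true) ^+ (c * size hs - sumn hs) * path_sum c b wt (column_word hs)
  = path_sum c b wt' (column_word (rev (map (subn c) hs))).
Proof.
move=> b_gt0 le_hs wt1 wt1' wtz wtx wty; set z := wt false true.
have splitE (x y : seq (int * int)) : ((clean (x ++ step_hor c :: y))%:R : R)
    = (clean (x ++ step_mark 1 :: nseq c step_open ++ y))%:R.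
  by rewrite clean_rot cat_cons clean_split [in RHS]clean_rot cat_cons -catA.
rewrite /path_sum !edgesum_columns // mulr_sumr size_rev size_map.
have inv_f : injective (fun m : bitseq => rev (map negb m)).
  by move=> m1 m2 /(can_inj revK)/(inj_map negb_inj).
rewrite -[RHS](perm_big _ (perm_masks (size hs) inv_f _)) /=; last first.
  by move=> m; rewrite size_rev size_map.
rewrite big_map big_seq [RHS]big_seq; apply: eq_bigr => m.
rewrite mem_masks => /eqP szm; rewrite mulrCA clean_sum_masked // wtz wtx wty.
have -> : count id (rev (map negb m)) = count negb m.
  by rewrite count_rev count_map; apply: eq_count => x.
have -> : count negb (rev (map negb m)) = count id m.
  by rewrite count_rev count_map; apply: eq_count => x; apply: negbK.
rewrite exprMn -exprM mulrA; congr (_ * _); ring.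
Qed.

(** * Compatible pairs as selections of edges *)

Lemma edgesum_masks (R : comNzRingType) c b (wt : bool -> bool -> R) w Q :
  edgesum c b wt w Q
  = \sum_(m <- masks (size w)) (\prod_(p <- zip w m) wt p.1 p.2)
      * Q [seq edge_step c b p.1 p.2 | p <- zip w m].
Proof.
elim: w Q => [|h w IH] Q /=; first by rewrite big_seq1 big_nil mul1r.
rewrite big_cat !big_map !IH !mulr_sumr; congr (_ + _); apply: eq_bigr => m _;
  by rewrite big_cons mulrA.
Qed.

Lemma big_set_masks (R : comNzRingType) n (F : bitseq -> R) :
  \sum_(T : {set 'I_n}) F [seq i \in T | i <- enum 'I_n] = \sum_(m <- masks n) F m.
Proof.
pose f (T : {set 'I_n}) : bitseq := [seq i \in T | i <- enum 'I_n].
rewrite -[LHS](big_map f xpredT F); apply: perm_big.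
have f_inj : injective f.
  move=> T1 T2 /eq_in_map eqT; apply/setP=> i; apply: eqT; exact: mem_enum.
apply: uniq_perm (uniq_masks n) _; first by rewrite map_inj_uniq // index_enum_uniq.
move=> m; rewrite mem_masks; apply/mapP/eqP => [[T _ ->]|szm].
  by rewrite size_map size_enum_ord.
exists [set i : 'I_n | nth false m i]; first exact: mem_index_enum.
apply: (@eq_from_nth _ false) => [|i lt_i]; first by rewrite size_map size_enum_ord.
have i0 : 'I_n by exists i; rewrite -szm.
by rewrite (nth_map i0) ?size_enum_ord -?szm // inE nth_enum_ord -?szm.
Qed.

Lemma val_iter_ordS n k (u : 'I_n) : val (iter k (@ordS n) u) = ((u + k) %% n)%N.
Proof.
elim: k => [|k IH] /=; first by rewrite addn0 modn_small.
by rewrite IH -addn1 modnDml addn1 addnS.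
Qed.

Lemma rot_enum_ord n (u : 'I_n) : rot u (enum 'I_n) = traject (@ordS n) u n.
Proof.
apply: (inj_map val_inj); rewrite map_rot val_enum_ord.
apply: (@eq_from_nth _ 0%N); rewrite ?size_rot ?size_map ?size_iota ?size_traject // => i lt_i.
rewrite (nth_map u) ?size_traject // nth_traject // val_iter_ordS.
have lt_u := ltn_ord u.
rewrite /rot nth_cat size_drop size_iota; case: ltnP => Hi.
  rewrite nth_drop nth_iota; last lia.
  rewrite modn_small; lia.
rewrite nth_take ?nth_iota; try lia.
have -> : (u + i = n + (i - (n - u)))%N by lia.
rewrite modnDl modn_small; lia.
Qed.

Lemma traject_split n (u : 'I_n) L : (L <= n)%N ->
  traject (@ordS n) u n
  = traject (@ordS n) u L ++ traject (@ordS n) (iter L (@ordS n) u) (n - L).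
Proof. by move=> le_L; rewrite -trajectD subnKC. Qed.

Lemma uniq_traject_ordS n (u : 'I_n) k : (k <= n)%N -> uniq (traject (@ordS n) u k).
Proof.
move=> le_k; have : uniq (traject (@ordS n) u n) by rewrite -rot_enum_ord rot_uniq enum_uniq.
by rewrite (traject_split u le_k) cat_uniq => /andP[].
Qed.

Lemma subpath_length_iter n (u : 'I_n) k : (0 < k <= n)%N ->
  subpath_length u (iter k (@ordS n) u) = k.
Proof.
move=> k_n; rewrite /subpath_length val_iter_ordS; have lt_u := ltn_ord u.
have [lt_n | le_n] := ltnP (u + k) n.
  rewrite modn_small //; case: ifP; lia.
have -> : (u + k = n + (u + k - n))%N by lia.
rewrite modnDl modn_small; last lia.
case: ifP; lia.
Qed.

Lemma subpath_length_bounds n (u v : 'I_n) : (0 < subpath_length u v <= n)%N.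
Proof. rewrite /subpath_length; have := ltn_ord u; have := ltn_ord v; case: ifP; lia. Qed.

Lemma iter_subpath_length n (u v : 'I_n) :
  iter (subpath_length u v) (@ordS n) u = v.
Proof.
apply: val_inj; rewrite val_iter_ordS /subpath_length.
have := ltn_ord u; have lt_v := ltn_ord v; case: ifP => lt_uv lt_u.
  by rewrite subnKC ?modn_small // ltnW.
have -> : (u + (n + v - u) = n + v)%N by lia.
by rewrite modnDl modn_small.
Qed.

(** Discrete intermediate values: the first sum cannot become negative, nor the
    second one positive, without vanishing. *)
Lemma conflict_of_neq0 (s : seq (int * int)) : (1 < size s)%N ->
    all (fun e : int * int => ((-1 : int) <= e.1) && (e.2 <= (1 : int))) s ->
    0 <= (head (step_mark 0) s).1 -> (last (step_mark 0) s).2 <= 0 ->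
    (forall t1 t2, s = t1 ++ t2 -> t1 != [::] -> t2 != [::] ->
       sum1 t1 != 0 /\ sum2 t2 != 0) ->
  conflict s.
Proof.
move=> szs /allP bnd hd lst nz; apply/conflictP; split=> // t1 t2 def n1 n2.
have rcons_n (t : seq (int * int)) e : rcons t e != [::] by case: t.
split.
  elim/last_ind: t1 t2 def n1 n2 => // t1 e IH t2 def _ n2.
  have [nzf _] := nz _ _ def (rcons_n t1 e) n2; move: nzf.
  rewrite -cats1 !step_sumE addr0.
  have [t10 | t1n] := eqVneq t1 [::].
    by move: hd; rewrite def t10 /= !step_sumE add0r; lia.
  have := IH (e :: t2); rewrite -cat_rcons -def => /(_ erefl t1n isT).
  have := bnd e; rewrite def mem_cat mem_rcons mem_head => /(_ isT)/andP[]; lia.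
elim: t2 t1 def n1 n2 => // e t2 IH t1 def n1 _.
have [_ nzg] := nz _ _ def n1 isT; move: nzg; rewrite !step_sumE.
have [t20 | t2n] := eqVneq t2 [::].
  by move: lst; rewrite def t20 cats1 last_rcons !step_sumE; lia.
have := IH (rcons t1 e); rewrite cat_rcons -def => /(_ erefl (rcons_n _ _) t2n).
have := bnd e; rewrite def mem_cat mem_head orbT => /(_ isT)/andP[]; lia.
Qed.

Section Compatible.
Variables (b c n : nat) (w : n.-tuple bool) (T : {set 'I_n}).

Definition step_at (i : 'I_n) := edge_step c b (tnth w i) (i \in T).

Lemma clean_traject :
  clean (map step_at (enum 'I_n)) =
  [forall u : 'I_n, forall L : 'I_n.+1, ~~ conflict (map step_at (traject (@ordS n) u L))].
Proof.
apply/cleanP/forallP => [cl u | cl u v t s def_s def_t].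
  apply/forallP=> L; have le_L : (L <= n)%N by rewrite -ltnS.
  have := rot_enum_ord u; rewrite (traject_split u le_L) => def.
  have := congr1 (map step_at) def; rewrite map_rot map_cat.
  apply: (cl (take u (map step_at (enum 'I_n))) (drop u (map step_at (enum 'I_n)))).
  by rewrite cat_take_drop.
apply/negP=> conf_t; have sz_t := conflict_size conf_t.
have sz_s : n = (size u + size v)%N.
  by have := congr1 size def_s; rewrite size_map size_enum_ord size_cat.
have sz_t' : (size v + size u = size t + size s)%N.
  by have := congr1 size def_t; rewrite !size_cat.
have [k def_rot] : exists k : 'I_n, v ++ u = rot k (map step_at (enum 'I_n)).
  case: (ltnP (size u) n) => [lt_u | ge_u].
    by exists (Ordinal lt_u); rewrite def_s rot_size_cat.
  have n_gt0 : (0 < n)%N by lia.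
  exists (Ordinal n_gt0); rewrite rot0 def_s.
  by case: v sz_s def_s {def_t sz_t'} => [|e v] /=; [rewrite cats0 | lia].
have lt_t : (size t < n.+1)%N by lia.
have /forallP/(_ (Ordinal lt_t)) := cl k; rewrite /= => /negP; apply.
move: def_t; rewrite def_rot -map_rot rot_enum_ord (traject_split k (lt_t : size t <= n)%N).
rewrite map_cat => /eqP; rewrite eqseq_cat ?size_map ?size_traject //.
by case/andP=> /eqP->.
Qed.

Lemma sum1_step_at (q : seq 'I_n) : sum1 (map step_at q) =
  (c * count (fun i => (i \in T) && tnth w i) q)%N%:Z - (count (fun i => ~~ tnth w i) q)%:Z.
Proof.
elim: q => [|i q IH] /=; first by rewrite step_sumE muln0.
rewrite step_sumE IH /step_at; case: (tnth w i) (i \in T) => [] [] /=; lia.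
Qed.

Lemma sum2_step_at (q : seq 'I_n) : sum2 (map step_at q) =
  (count (fun i => tnth w i) q)%:Z - (b * count (fun i => (i \in T) && ~~ tnth w i) q)%N%:Z.
Proof.
elim: q => [|i q IH] /=; first by rewrite step_sumE muln0.
rewrite step_sumE IH /step_at; case: (tnth w i) (i \in T) => [] [] /=; lia.
Qed.

(** A subpath never visits an edge twice. *)
Lemma card_subpath (X : {set 'I_n}) A B :
  #|[set e in subpath A B] :&: X| = count (mem X) (subpath A B).
Proof.
have uq : uniq (subpath A B).
  by apply: uniq_traject_ordS; case/andP: (subpath_length_bounds A B).
rewrite -size_filter -(card_uniqP (filter_uniq _ uq)).
by apply: eq_card => i; rewrite !inE mem_filter andbC.
Qed.

Lemma interiorP (u v : 'I_n) A :
  reflect (exists2 m, (0 < m < subpath_length u v)%N & A = iter m (@ordS n) u)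
          (A \in interior u v).
Proof.
rewrite /interior /subpath; case/andP: (subpath_length_bounds u v).
case: (subpath_length u v) => // L _ _; rewrite trajectS /=.
apply: (iffP trajectP) => [[m lt_m ->] | [[//|m] lt_m ->]].
  by exists m.+1; rewrite ?iterSr.
by exists m; rewrite ?iterSr.
Qed.

Lemma compatible_clean :
  compatible b c w (T :&: horizontal_edges w) (T :&: vertical_edges w)
  = clean (map step_at (enum 'I_n)).
Proof.
(* The two conditions at the interior point A, m steps after u. *)
have cutE u L m : (0 < m < L)%N -> (L <= n)%N ->
    let F := iter L (@ordS n) u in let A := iter m (@ordS n) u in
    ((#|subpath_hor w A F| == b * #|subpath_ver w A F :&: (T :&: vertical_edges w)|)%N
     = (sum2 (map step_at (traject (@ordS n) A (L - m))) == 0))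
    * ((#|subpath_ver w u A| == c * #|subpath_hor w u A :&: (T :&: horizontal_edges w)|)%N
     = (sum1 (map step_at (traject (@ordS n) u m)) == 0)).
  move=> m_L L_n F A; have mn : (0 < m <= n)%N by lia.
  have Lmn : (0 < L - m <= n)%N by lia.
  rewrite sum2_step_at sum1_step_at /subpath_hor /subpath_ver -!setIA !card_subpath.
  have -> : subpath u A = traject (@ordS n) u m by rewrite /subpath subpath_length_iter.
  have -> : subpath A F = traject (@ordS n) A (L - m).
    rewrite /subpath; have -> : F = iter (L - m) (@ordS n) A by rewrite -iterD subnK //; lia.
    by rewrite subpath_length_iter.
  have cE (X : {set 'I_n}) (p : pred 'I_n) q : X =i p -> count (mem X) q = count p q.
    by move=> eqX; apply: eq_count => i; apply: eqX.
  rewrite (cE (horizontal_edges w) (fun i => tnth w i)); last by move=> i; rewrite inE.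
  rewrite (cE (vertical_edges w) (fun i => ~~ tnth w i)); last by move=> i; rewrite inE.
  rewrite (cE (_ :&: (_ :&: vertical_edges w)) (fun i => (i \in T) && ~~ tnth w i)); last first.
    by move=> i; rewrite !inE andbCA andbb.
  rewrite (cE (_ :&: (_ :&: horizontal_edges w)) (fun i => (i \in T) && tnth w i)); last first.
    by move=> i; rewrite !inE andbCA andbb.
  by split; rewrite subr_eq0 eqz_nat // eq_sym.
have trajE u L m : (m <= L)%N -> traject (@ordS n) u L
    = traject (@ordS n) u m ++ traject (@ordS n) (iter m (@ordS n) u) (L - m).
  by move=> le_m; rewrite -trajectD subnKC.
(* The cuts of a subpath into two nonempty parts are at its interior points. *)
have cutP u L t1 t2 : map step_at (traject (@ordS n) u L) = t1 ++ t2 ->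
    t1 != [::] -> t2 != [::] -> exists2 m, (0 < m < L)%N &
    t1 = map step_at (traject (@ordS n) u m)
    /\ t2 = map step_at (traject (@ordS n) (iter m (@ordS n) u) (L - m)).
  move=> def; rewrite !neq_nil => n1 n2.
  have sz : L = (size t1 + size t2)%N.
    by have := congr1 size def; rewrite size_map size_traject size_cat.
  have m_L : (0 < size t1 < L)%N by lia.
  exists (size t1) => //; have le_m : (size t1 <= L)%N by lia.
  move: def; rewrite (trajE u L _ le_m) map_cat => /eqP.
  by rewrite eqseq_cat ?size_map ?size_traject // => /andP[/eqP e1 /eqP e2]; split.
rewrite clean_traject; apply/idP/forallP => [/'forall_in_forall_inP cmp u | cl].
  apply/forallP=> -[L /= lt_L]; apply/negP=> conf_t.
  have le_L : (L <= n)%N by [].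
  have L_gt1 : (1 < L)%N by have := conflict_size conf_t; rewrite size_map size_traject.
  have [L' def_L] : exists L', L = L'.+1 by exists L.-1; lia.
  pose v := iter L' (@ordS n) u.
  have vF : ordS v = iter L (@ordS n) u by rewrite def_L.
  have uS : u \in T :&: horizontal_edges w.
    move: (conf_t); rewrite def_L /= => /conflict_head; rewrite !inE /step_at.
    by case: (tnth w u) (u \in T) => [] [].
  have vS : v \in T :&: vertical_edges w.
    move: (conf_t); rewrite def_L trajectSr map_rcons => /conflict_last; rewrite !inE /step_at.
    by rewrite -/v; case: (tnth w v) (v \in T) => [] [].
  have := cmp u uS v vS; rewrite vF => /exists_inP[A /interiorP[m]].
  rewrite subpath_length_iter; last by lia.
  move=> m_L ->; rewrite !(cutE u L m) //.
  case/conflictP: conf_t => _ /(_ (map step_at (traject (@ordS n) u m))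
    (map step_at (traject (@ordS n) (iter m (@ordS n) u) (L - m)))).
  have le_m : (m <= L)%N by lia.
  rewrite (trajE u L m le_m) map_cat !neq_nil !size_map !size_traject.
  by move=> /(_ erefl)[|| f0 g0]; try lia; rewrite (gt_eqF f0) (lt_eqF g0).
apply/'forall_in_forall_inP => u uS v vS.
have /andP[L_gt0 le_L] := subpath_length_bounds u (ordS v).
set L := subpath_length _ _ in L_gt0 le_L.
have vF : iter L (@ordS n) u = ordS v by apply: iter_subpath_length.
have lt_L : (L < n.+1)%N by [].
have [L' def_L] : exists L', L = L'.+1 by exists L.-1; lia.
have def_v : iter L' (@ordS n) u = v by apply: (@ordS_inj n); rewrite -vF def_L.
have L_gt1 : (1 < L)%N.
  rewrite def_L; case: (L') def_v => // /= uv; move: uS vS; rewrite !inE uv.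
  by case: (tnth w v) => /andP[] // _ _ /andP[].
have /forallP/(_ (Ordinal lt_L)) /= := cl u; apply: contraNT => /exists_inPn noA.
apply: conflict_of_neq0; first by rewrite size_map size_traject.
- apply/allP=> _ /mapP[i _ ->]; rewrite /step_at.
  by case: (tnth w i) (i \in T) => [] [] /=; rewrite /edge_step /=; lia.
- rewrite def_L /= /step_at; move: uS; rewrite !inE => /andP[-> ->] //.
- rewrite def_L trajectSr map_rcons last_rcons def_v /step_at; move: vS.
  by rewrite !inE => /andP[-> /negPf->] /=; lia.
move=> t1 t2 def n1 n2; have [m m_L [-> ->]] := cutP _ _ _ _ def n1 n2.
have := noA (iter m (@ordS n) u); rewrite -vF !(cutE u L m) // negb_or.
move=> H; apply/andP; rewrite andbC; apply: H; apply/interiorP.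
by exists m => //; rewrite subpath_length_iter //; lia.
Qed.
End Compatible.

(** Edges that are horizontal and not selected count for y_1, and edges that are
    vertical and selected for y_2, as in y_1 ^ (a_1 - |S_1|) * y_2 ^ |S_2|. *)
Definition monomial_weight (R : comNzRingType) (y1 y2 : R) (h sel : bool) : R :=
  if h then if sel then 1 else y1 else if sel then y2 else 1.

Lemma sum_compatible (R : comNzRingType) b c n (w : n.-tuple bool) (y1 y2 : R) :
  \sum_(S | compatible_pair b c w S)
     y1 ^+ (#|horizontal_edges w| - #|S.1|) * y2 ^+ #|S.2|
  = path_sum c b (monomial_weight y1 y2) w.
Proof.
set H := horizontal_edges w; set V := vertical_edges w.
have HV T : (T :&: H) :|: (T :&: V) = T.
  by apply/setP=> i; rewrite !inE -andb_orr orbN andbT.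
rewrite (reindex_onto (fun T : {set 'I_n} => (T :&: H, T :&: V))
                      (fun S => S.1 :|: S.2)) /=; last first.
  move=> [S1 S2] /and3P[/= /subsetP S1H /subsetP S2V _].
  congr (_, _); apply/setP=> i; rewrite !inE.
    have [iS1 | nS1] := boolP (i \in S1); first by have := S1H _ iS1; rewrite inE => ->.
    by have [/S2V | //] := boolP (i \in S2); rewrite inE => /negPf->.
  have [iS2 | nS2] := boolP (i \in S2); first by have := S2V _ iS2; rewrite inE orbT => ->.
  have [iS1 | //] := boolP (i \in S1); have := S1H _ iS1; rewrite inE => -> //.
rewrite /path_sum edgesum_masks size_tuple -big_set_masks.
have zipE (T : {set 'I_n}) : zip w [seq i \in T | i <- enum 'I_n]
    = [seq (tnth w i, i \in T) | i <- enum 'I_n].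
  by rewrite -[X in zip X _](map_tnth_enum w) zip_map.
rewrite [RHS](bigID (fun T => compatible_pair b c w (T :&: H, T :&: V))) /=.
rewrite [X in _ = _ + X]big1 => [|T]; last first.
  rewrite /compatible_pair !subsetIr /= compatible_clean => /negPf ncl.
  rewrite zipE -map_comp -[X in clean X]/(map (step_at b c w T) (enum 'I_n)).
  by rewrite ncl mulr0.
rewrite addr0; apply: eq_big => [T | T cT]; first by rewrite HV eqxx andbT.
rewrite zipE -map_comp -[X in clean X]/(map (step_at b c w T) (enum 'I_n)).
move: cT; rewrite /compatible_pair !subsetIr /= compatible_clean HV eqxx andbT => cl.
rewrite cl mulr1.
rewrite big_map /= big_enum /=.
rewrite (eq_bigr (fun i => (if i \in H :\: T then y1 else 1) * (if i \in T :&: V then y2 else 1))).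
  rewrite big_split -!big_mkcond /= !prodr_const cardsD setIC.
  by congr (_ ^+ _ * _ ^+ _).
move=> i _; rewrite !inE /monomial_weight.
by case: (tnth w i) (i \in T) => [] [] /=; rewrite ?mulr1 ?mul1r.
Qed.

(** * Change of the path in the sum over compatible pairs *)

Definition compatible_sum (R : comNzRingType) (b c a1 a2 : nat) (y1 y2 : R) : R :=
  \sum_(S | compatible_pair b c (maximal_Dyck_path a1 a2) S)
     y1 ^+ (a1 - #|S.1|) * y2 ^+ #|S.2|.

Lemma card_horizontal n (w : n.-tuple bool) : #|horizontal_edges w| = count id w.
Proof.
rewrite cardE /enum_mem size_filter -[X in count id X](map_tnth_enum w) count_map enumT.
by apply: eq_count => i; rewrite /= inE.
Qed.

Lemma card_vertical n (w : n.-tuple bool) : #|vertical_edges w| = count negb w.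
Proof.
rewrite cardE /enum_mem size_filter -[X in count negb X](map_tnth_enum w) count_map enumT.
by apply: eq_count => i; rewrite /= inE.
Qed.

Lemma maximal_Dyck_path0 : maximal_Dyck_path 0 0 = [::] :> bitseq.
Proof. by apply: size0nil; rewrite size_tuple. Qed.

Lemma count_hor_Dyck a1 a2 : count id (maximal_Dyck_path a1 a2) = a1.
Proof.
have [/eqP | n_gt0] := posnP (a1 + a2)%N.
  by rewrite addn_eq0 => /andP[/eqP-> /eqP->]; rewrite maximal_Dyck_path0.
by have [] := maximal_Dyck_path_spec n_gt0.
Qed.

Lemma count_ver_Dyck a1 a2 : count negb (maximal_Dyck_path a1 a2) = a2.
Proof.
have : (count id (maximal_Dyck_path a1 a2) + count negb (maximal_Dyck_path a1 a2)
        = size (maximal_Dyck_path a1 a2))%N := count_predC id _.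
by rewrite size_tuple count_hor_Dyck => /addnI.
Qed.

Lemma rev_Dyck a1 a2 :
  rev (map negb (maximal_Dyck_path a1 a2)) = maximal_Dyck_path a2 a1 :> bitseq.
Proof.
have [/eqP | n_gt0] := posnP (a1 + a2)%N; last exact: maximal_Dyck_path_rev.
by rewrite addn_eq0 => /andP[/eqP-> /eqP->]; rewrite maximal_Dyck_path0.
Qed.

Lemma compatible_sumE (R : comNzRingType) b c a1 a2 (y1 y2 : R) :
  compatible_sum b c a1 a2 y1 y2
  = path_sum c b (monomial_weight y1 y2) (maximal_Dyck_path a1 a2).
Proof.
by rewrite -sum_compatible card_horizontal count_hor_Dyck.
Qed.

Lemma compatible_sum00 (R : comNzRingType) b c (y1 y2 : R) :
  compatible_sum b c 0 0 y1 y2 = 1.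
Proof. by rewrite compatible_sumE maximal_Dyck_path0. Qed.

Lemma compatible_sum10 (R : comNzRingType) b c (y1 y2 : R) :
  compatible_sum b c 1 0 y1 y2 = 1 + y1.
Proof.
rewrite compatible_sumE maximal_Dyck_path_columns // /path_sum /heights /=.
by rewrite !mulr1 addrC.
Qed.

Lemma path_sum_scale (R : comNzRingType) (wt' : bool -> bool -> R) (k : bool -> R)
    c b wt w :
  (forall h s, wt h s = k h * wt' h s) ->
  path_sum c b wt w
  = k true ^+ count id w * k false ^+ count negb w * path_sum c b wt' w.
Proof. exact: edgesum_scale. Qed.
Arguments path_sum_scale [R] wt' k [c b wt w].

Section Field.
Variable K : fieldType.
Implicit Types y : K.

Lemma compatible_sum_reflect b c a1 a2 y1 y2 : y1 != 0 -> y2 != 0 ->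
  compatible_sum b c a1 a2 y1 y2
  = y1 ^+ a1 * y2 ^+ a2 * compatible_sum c b a2 a1 y2^-1 y1^-1.
Proof.
move=> y1n y2n; rewrite !compatible_sumE path_sum_dual rev_Dyck.
rewrite (path_sum_scale (monomial_weight y2^-1 y1^-1) (fun h => if h then y2 else y1)).
  by rewrite count_hor_Dyck count_ver_Dyck [_ ^+ a2 * _]mulrC.
by case=> [] []; rewrite /monomial_weight /= ?mulr1 ?divff.
Qed.

Lemma compatible_sum01 b c y1 y2 : y1 != 0 -> y2 != 0 ->
  compatible_sum b c 0 1 y1 y2 = 1 + y2.
Proof.
move=> y1n y2n; rewrite compatible_sum_reflect // compatible_sum10.
by rewrite expr0 expr1 mul1r mulrDr mulr1 divff // addrC.
Qed.

(** The change of F-polynomials under the mutation of the initial seed at the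
    vertex 1. The path is reversed so that the vertical edges take the part of
    the horizontal ones in path_sum_complement. *)
Lemma compatible_sum_shift b c a1 a2 y1 y2 : (0 < c)%N ->
    y1 != 0 -> 1 + y1 != 0 -> (a1 <= b * a2)%N ->
  compatible_sum b c a1 a2 y1 y2
  = (1 + y1) ^+ a1 * compatible_sum c b a2 (b * a2 - a1)
      (y2 * y1 ^+ b / (1 + y1) ^+ b) y1^-1.
Proof.
move=> c_gt0 y1n y1n' le_a1.
have [a20 | a2_gt0] := posnP a2.
  rewrite a20 muln0 leqn0 in le_a1; rewrite a20 (eqP le_a1) muln0.
  by rewrite !compatible_sum00 mul1r.
have yE : 1 + y1 = y1 * (1 + y1^-1) by rewrite mulrDr mulr1 divff // addrC.
have u_n : 1 + y1^-1 != 0 by apply: contraNneq y1n' => u0; rewrite yE u0 mulr0.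
(* The weights on the reversed path, after extraction of y1 from its vertical
   edges, and those on the path of complementary heights. *)
pose wt1 (h s : bool) : K := if h then (if s then y2 else 1) else (if s then y1^-1 else 1).
pose wt2 (h s : bool) : K :=
  if h then (if s then (1 + y1^-1) ^+ b else y2) else (if s then y1^-1 else 1).
rewrite !compatible_sumE path_sum_dual rev_Dyck.
rewrite (path_sum_scale wt1 (fun h => if h then 1 else y1)); last first.
  by case=> [] []; rewrite /monomial_weight /wt1 /= ?mulr1 ?mul1r ?divff.
rewrite expr1n mul1r count_ver_Dyck.
have := path_sum_complement (wt := wt1) (wt' := wt2) c_gt0 (heights_le a2_gt0 le_a1)
  erefl erefl erefl erefl (esym (mul1r _)).
rewrite size_heights sumn_heights // heights_complement // -!maximal_Dyck_path_columns //.
rewrite [X in _ = X](path_sum_scale (monomial_weight (y2 / (1 + y1^-1) ^+ b) y1^-1)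
   (fun h => if h then (1 + y1^-1) ^+ b else 1)); last first.
  case=> [] []; rewrite /monomial_weight /wt2 /= ?mulr1 ?mul1r //.
  by rewrite mulrC divfK // expf_neq0.
rewrite count_hor_Dyck expr1n mulr1 -exprM.
rewrite yE !exprMn invfM (mulrA _ (y1 ^- b)) mulfK ?expf_neq0 //.
set F := path_sum b c wt1 _; set F' := path_sum b c _ _ => eqF.
rewrite -mulrA; congr (_ * _); apply: (mulfI (expf_neq0 (b * a2 - a1) u_n)).
rewrite {}eqF mulrA -exprD subnK //.
Qed.
End Field.

(** * Exchange relations *)

(** The denominator vectors of the new cluster variables in the direction that
    starts with the mutation at 1. A mutation of the initial seed relates them to
    those for (c, b), one step earlier. The value at 0 stands for an initial
    variable: its compatible_sum is 1. *)
Fixpoint dvec (b c n : nat) : nat * nat :=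
  match n with
  | 0 => (0, 0)
  | 1 => (1, 0)
  | n'.+1 => (b * (dvec c b n').1 - (dvec c b n').2, (dvec c b n').1)
  end%N.

(** No subtraction is truncated in the computation of dvec up to the index N. *)
Definition genuine b c N := forall m, (0 < m < N)%N ->
  ((dvec b c m).2 <= c * (dvec b c m).1)%N /\ ((dvec c b m).2 <= b * (dvec c b m).1)%N.

Lemma genuineC b c N : genuine b c N -> genuine c b N.
Proof. by move=> gen m /gen[]. Qed.

Lemma genuineS b c N : genuine b c N.+1 -> genuine b c N.
Proof. by move=> gen m m_N; apply: gen; lia. Qed.

Lemma dvecSS b c n : dvec b c n.+2
  = (b * (dvec c b n.+1).1 - (dvec c b n.+1).2, (dvec c b n.+1).1)%N.
Proof. by []. Qed.

Lemma dvec_snd b c n : (dvec b c n.+1).2 = (dvec c b n).1.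
Proof. by case: n. Qed.

Lemma dvec_fst b c n : genuine b c n.+2 ->
  ((dvec b c n.+2).1 + (dvec b c n).1 = b * (dvec c b n.+1).1)%N.
Proof.
move=> gen; have [|_] := gen n.+1; first by lia.
by rewrite dvecSS -(dvec_snd c b) => /subnK.
Qed.

(** The first components for (b, c) and (c, b) are equal at the odd indices and
    proportional at the even ones. *)
Lemma dvec_parity b c n : genuine b c n ->
  (if odd n then (dvec b c n).1 = (dvec c b n).1
   else c * (dvec b c n).1 = b * (dvec c b n).1)%N.
Proof.
have [N] := ubnP n; elim: N n => // N IH [|[|n]] ltnN gen //; first by rewrite !muln0.
have h1 := IH n.+1 ltac:(lia) (genuineS gen).
have h2 := IH n ltac:(lia) (genuineS (genuineS gen)).
have e1 := dvec_fst gen; have e2 := dvec_fst (genuineC gen).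
have -> : odd n.+2 = odd n by rewrite /= negbK.
move: h1 h2; rewrite [odd n.+1]/=; case: (odd n) => h1 h2;
  cbv beta iota delta [negb] in h1, h2.
  by apply: (@addIn (dvec b c n).1); rewrite e1 h2 e2.
have : (c * ((dvec b c n.+2).1 + (dvec b c n).1)
        = b * ((dvec c b n.+2).1 + (dvec c b n).1))%N.
  by rewrite e1 e2 h1 mulnCA.
by rewrite !mulnDr h2 => /addIn.
Qed.

(** The exponent of the n-th variable in the exchange relation between its two
    neighbours. *)
Definition exchange_exponent (b c n : nat) : nat := if odd n then b else c.

Lemma exchange_exponentS b c n : exchange_exponent b c n.+1 = exchange_exponent c b n.
Proof. by rewrite /exchange_exponent /=; case: (odd n). Qed.

Lemma dvec_rec1 b c n : genuine b c n.+2 ->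
  ((dvec b c n.+2).1 + (dvec b c n).1 = exchange_exponent b c n.+1 * (dvec b c n.+1).1)%N.
Proof.
move=> gen; rewrite dvec_fst //; have := dvec_parity (genuineS gen).
by rewrite /exchange_exponent; case: (odd n.+1) => ->.
Qed.

Lemma dvec_rec2 b c n : genuine b c n.+3 ->
  ((dvec b c n.+3).2 + (dvec b c n.+1).2 = exchange_exponent b c n.+2 * (dvec b c n.+2).2)%N.
Proof.
move=> gen; rewrite !dvec_snd exchange_exponentS dvec_rec1 //.
exact: genuineC (genuineS gen).
Qed.

(** A set of nonzero elements which contains all values of subtraction-free
    expressions, so that no division below is a division by zero. *)
Record positive_cone (K : fieldType) (pos : K -> Prop) : Prop := PositiveCone {
  pos_1 : pos 1;
  pos_D : forall x y, pos x -> pos y -> pos (x + y);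
  pos_M : forall x y, pos x -> pos y -> pos (x * y);
  pos_V : forall x, pos x -> pos x^-1;
  pos_neq0 : forall x, pos x -> x != 0
}.

Section Exchange.
Variables (K : fieldType) (pos : K -> Prop).
Hypothesis posK : positive_cone pos.
Implicit Types y : K.

Lemma pos_X x n : pos x -> pos (x ^+ n).
Proof.
move=> px; elim: n => [|n IH]; first exact: pos_1 posK.
by rewrite exprS; apply: (pos_M posK).
Qed.

Lemma pos_compatible_sum b c a1 a2 y1 y2 : pos y1 -> pos y2 ->
  pos (compatible_sum b c a1 a2 y1 y2).
Proof.
move=> p1 p2; rewrite /compatible_sum (bigD1 (set0, set0)) /=; last first.
  rewrite /compatible_pair !sub0set /=.
  by apply/'forall_in_forall_inP => u; rewrite inE.
set s := \sum_(_ | _) _; have : s = 0 \/ pos s.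
  apply: (big_ind (fun s => s = 0 \/ pos s)); first by left.
    move=> x y [->|px] [->|py]; rewrite ?addr0 ?add0r; [by left | by right .. | right].
    exact: (pos_D posK).
  by move=> S _; right; apply: (pos_M posK); apply: pos_X.
have p : pos (y1 ^+ (a1 - #|@set0 'I_(a1 + a2)|) * y2 ^+ #|@set0 'I_(a1 + a2)|).
  by apply: (pos_M posK); apply: pos_X.
by case=> [-> | ps]; [rewrite addr0 | apply: (pos_D posK)].
Qed.

Definition forward_sum b c n y1 y2 :=
  compatible_sum b c (dvec b c n).1 (dvec b c n).2 y1 y2.

Lemma forward_sum_shift b c n y1 y2 : (0 < c)%N -> genuine b c n.+1 ->
    y1 != 0 -> 1 + y1 != 0 ->
  forward_sum b c n.+1 y1 y2 = (1 + y1) ^+ (dvec b c n.+1).1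
     * forward_sum c b n (y2 * y1 ^+ b / (1 + y1) ^+ b) y1^-1.
Proof.
move=> c_gt0 gen y1n y1n'; rewrite /forward_sum.
case: n gen => [|n] gen; first by rewrite compatible_sum10 compatible_sum00 mulr1 expr1.
have [|_ le_n] := gen n.+1; first by lia.
rewrite dvecSS [X in _ = X]/= [LHS]compatible_sum_shift //; last exact: leq_subr.
by rewrite subKn.
Qed.

(** The change of the initial seed turns this relation into the previous one for
    (c, b), evaluated at other elements of the cone. *)
Theorem forward_exchange b c n y1 y2 : (0 < b)%N -> (0 < c)%N ->
    genuine b c n.+2 -> pos y1 -> pos y2 ->
  forward_sum b c n.+2 y1 y2 * forward_sum b c n y1 y2
  = y1 ^+ (dvec b c n.+2).1 * y2 ^+ (dvec b c n.+2).2
    + forward_sum b c n.+1 y1 y2 ^+ exchange_exponent b c n.+1.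
Proof.
elim: n b c y1 y2 => [|n IH] b c y1 y2 b_gt0 c_gt0 gen p1 p2;
  have y1n := pos_neq0 posK p1;
  have p1' := pos_D posK (pos_1 posK) p1; have y1n' := pos_neq0 posK p1'.
  rewrite forward_sum_shift // /forward_sum !compatible_sum10 !compatible_sum00 mulr1.
  rewrite /= muln1 subn0 expr1 mulrDr mulr1 mulrC divfK ?expf_neq0 //.
  by rewrite addrC [y2 * _]mulrC.
have genC := genuineC (genuineS gen).
have gen2 := genuineS gen; have gen1 := genuineS gen2.
rewrite !(@forward_sum_shift b c _ y1 y2) //.
set z1 := y2 * _ / _; set z2 := y1^-1.
have pz1 : pos z1.
  by apply: (pos_M posK); [apply: (pos_M posK) | apply: (pos_V posK)] => //; apply: pos_X.
have pz2 : pos z2 by apply: (pos_V posK).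
rewrite mulrACA -exprD IH // mulrDr [in RHS]exprMn -exprM; congr (_ + _); last first.
  by rewrite dvec_rec1 // exchange_exponentS mulnC.
rewrite dvec_fst // [dvec b c n.+3]dvecSS [(_, _).1]/= [(_, _).2]/=.
have [|_ le_n] := gen n.+2; first by lia.
set P := (dvec c b n.+2).1 in le_n *; set Q := (dvec c b n.+2).2 in le_n *.
rewrite /z1 /z2 !exprMn !exprVn -!exprM.
(* (P, Q) is a vector for (c, b), and (b P - Q, P) the next one for (b, c). *)
have -> : y1 ^+ (b * P) = y1 ^+ (b * P - Q) * y1 ^+ Q by rewrite -exprD subnK.
have n1 : (1 + y1) ^+ (b * P) != 0 by rewrite expf_neq0.
have n2 : y1 ^+ Q != 0 by rewrite expf_neq0.
by field; rewrite n1 n2.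
Qed.

(** Exchanging the two vertices of the initial seed exchanges the directions of
    the tree; on the level of paths this is the reversal. *)
Definition backward_sum b c n y1 y2 :=
  compatible_sum b c (dvec c b n).2 (dvec c b n).1 y1 y2.

Lemma backward_sumE b c n y1 y2 : y1 != 0 -> y2 != 0 ->
  backward_sum b c n y1 y2 = y1 ^+ (dvec c b n).2 * y2 ^+ (dvec c b n).1
                             * forward_sum c b n y2^-1 y1^-1.
Proof. exact: compatible_sum_reflect. Qed.

Theorem backward_exchange b c n y1 y2 : (0 < b)%N -> (0 < c)%N ->
    genuine b c n.+3 -> pos y1 -> pos y2 ->
  backward_sum b c n.+3 y1 y2 * backward_sum b c n.+1 y1 y2
  = y1 ^+ (dvec c b n.+1).2 * y2 ^+ (dvec c b n.+1).1
    + backward_sum b c n.+2 y1 y2 ^+ exchange_exponent c b n.+2.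
Proof.
move=> b_gt0 c_gt0 gen p1 p2; have gen' := genuineC gen.
have y1n := pos_neq0 posK p1; have y2n := pos_neq0 posK p2.
rewrite !backward_sumE // mulrACA forward_exchange //; try exact: (pos_V posK).
rewrite mulrACA -!exprD dvec_rec1 // dvec_rec2 // mulrDr !exprMn -!exprM.
rewrite -!(mulnC (exchange_exponent _ _ _)); congr (_ + _).
rewrite -dvec_rec1 // -dvec_rec2 // !exprD !exprVn.
have n1 : y1 ^+ (dvec c b n.+3).2 != 0 by rewrite expf_neq0.
have n2 : y2 ^+ (dvec c b n.+3).1 != 0 by rewrite expf_neq0.
by field; rewrite n1 n2.
Qed.

(** The first relation in this direction has another form, because the coefficient
    y_1 still has a positive exponent. *)
Lemma backward_exchange0 b c y1 y2 : (0 < b)%N -> (0 < c)%N -> pos y1 -> pos y2 ->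
  backward_sum b c 2 y1 y2 = 1 + y1 * backward_sum b c 1 y1 y2 ^+ c.
Proof.
move=> b_gt0 c_gt0 p1 p2.
have y1n := pos_neq0 posK p1; have y2n := pos_neq0 posK p2.
have gen : genuine c b 2 by case=> [|[|m]].
have := @forward_exchange c b 0 y2^-1 y1^-1 c_gt0 b_gt0 gen (pos_V posK p2) (pos_V posK p1).
rewrite !backward_sumE // /forward_sum compatible_sum00 mulr1 => ->.
rewrite /= muln1 subn0 expr1 expr0 !exprVn /exchange_exponent /= !mul1r exprMn.
have n2 : y2 ^+ c != 0 by rewrite expf_neq0.
by field; rewrite y1n n2.
Qed.

End Exchange.

Local Notation tofrac := FracField.tofrac.

(** * Values of cluster variables at x_1 = x_2 = 1 *)

Section FractionValue.
Variables (A : idomainType) (F : fieldType) (ev : {rmorphism A -> F}).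

(** The relation specialized_at_1, for an arbitrary evaluation ev. *)
Definition fraction_value (z : {fraction A}) (v : F) : Prop :=
  exists p q : A, [/\ ev q != 0, z = tofrac p / tofrac q & v = ev p / ev q].

Lemma tofrac_neq0 (r : A) : ev r != 0 -> tofrac r != 0.
Proof.
by move=> rn; rewrite tofrac_eq0; apply: contraNneq rn => ->; rewrite rmorph0.
Qed.

Lemma fraction_value_uniq z v v' :
  fraction_value z v -> fraction_value z v' -> v = v'.
Proof.
move=> [p [q [qn -> ->]]] [p' [q' [qn' eqz ->]]].
have /eqP := eqz; rewrite eqr_div ?tofrac_neq0 // -!tofracM tofrac_eq => /eqP eqpq.
by apply/eqP; rewrite eqr_div // -!rmorphM eqpq.
Qed.

Lemma fraction_value_poly p : fraction_value (tofrac p) (ev p).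
Proof. by exists p, 1; rewrite rmorph1 tofrac1 !divr1 oner_neq0. Qed.

Lemma fraction_valueM z v z' v' :
  fraction_value z v -> fraction_value z' v' -> fraction_value (z * z') (v * v').
Proof.
move=> [p [q [qn -> ->]]] [p' [q' [qn' -> ->]]].
by exists (p * p'), (q * q'); rewrite !rmorphM !mulf_div mulf_neq0.
Qed.

Lemma fraction_valueV z v : v != 0 -> fraction_value z v -> fraction_value z^-1 v^-1.
Proof.
move=> vn [p [q [qn -> ev_v]]]; exists q, p; rewrite ev_v !invf_div; split=> //.
by apply: contraNneq vn => p0; rewrite ev_v p0 mul0r.
Qed.

Lemma fraction_valueD z v z' v' :
  fraction_value z v -> fraction_value z' v' -> fraction_value (z + z') (v + v').
Proof.
move=> [p [q [qn -> ->]]] [p' [q' [qn' -> ->]]].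
exists (p * q' + p' * q), (q * q'); rewrite !rmorphD !rmorphM.
by rewrite mulf_neq0 // !addf_div ?tofrac_neq0.
Qed.

Lemma fraction_value1 : fraction_value 1 1.
Proof. by have := fraction_value_poly 1; rewrite tofrac1 rmorph1. Qed.

Lemma fraction_valueX z v n : fraction_value z v -> fraction_value (z ^+ n) (v ^+ n).
Proof.
move=> sz; elim: n => [|n IH]; first exact: fraction_value1.
by rewrite !exprS; apply: fraction_valueM.
Qed.

End FractionValue.

Definition eval1 : {rmorphism {mpoly QP[2]} -> QP} := meval (fun=> 1 : QP).

Lemma fraction_value_const a : fraction_value eval1 (ambient_of_QP a) a.
Proof. by have := fraction_value_poly eval1 a%:MP; rewrite /eval1 /= mevalC. Qed.

Section Monomial.
Variables (K : fieldType) (y : 'I_2 -> K).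
Hypothesis y_neq0 : forall j, y j != 0.

Definition laurent_monomial (d : Trop) : K := \prod_(j < 2) y j ^ (d 0 j).

Lemma laurent_monomial_neq0 d : laurent_monomial d != 0.
Proof. by apply/prodf_neq0 => j _; rewrite expfz_neq0. Qed.

Lemma laurent_monomialD d e :
  laurent_monomial (d + e) = laurent_monomial d * laurent_monomial e.
Proof.
by rewrite /laurent_monomial -big_split; apply: eq_bigr => j _; rewrite mxE expfzDr.
Qed.

Lemma laurent_monomialN d : laurent_monomial (- d) = (laurent_monomial d)^-1.
Proof.
by rewrite /laurent_monomial -prodfV; apply: eq_bigr => j _; rewrite mxE invr_expz.
Qed.
End Monomial.

(** If o is the parity of t, then vertex_index o is the label of the edge from t
    to t + 1, and vertex_index (~~ o) that of the edge from t - 1 to t. *)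
Definition vertex_index (o : bool) : 'I_2 := if o then 1 else 0.

Lemma vertex_index_neq o : vertex_index (~~ o) == vertex_index o = false.
Proof. by case: o. Qed.

Lemma prod_vertex (R : comNzRingType) (F : 'I_2 -> R) o :
  \prod_(i < 2) F i = F (vertex_index o) * F (vertex_index (~~ o)).
Proof.
have -> : \prod_(i < 2) F i = F 0 * F 1.
  by rewrite big_ord_recl big_ord1; congr (_ * F _); apply: val_inj.
by case: o => //=; rewrite mulrC.
Qed.

(** Dividing a monomial d and 1 by their tropical sum leaves the monomials
    trop_pos d and trop_neg d, with nonnegative exponents. *)
Definition trop_pos (d : Trop) : Trop := d - trop_add d 0.
Definition trop_neg (d : Trop) : Trop := - trop_add d 0.

Definition y_var (j : 'I_2) : QP := tofrac ('X_j : {mpoly int[2]}).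

Lemma y_var_neq0 j : y_var j != 0.
Proof.
rewrite tofrac_eq0; apply/eqP => /(congr1 (meval (fun=> 1))).
by rewrite mevalXU meval0 => /eqP; rewrite oner_eq0.
Qed.

Lemma factor_inverse (K : fieldType) (a m x y z : K) :
  (a * m^-1 * x + m^-1 * y) / z = (a * x + y) * (m * z)^-1.
Proof. by rewrite invfM; ring. Qed.

Lemma mutate_cluster_value o s vA vB :
    let k := vertex_index o in let j := vertex_index (~~ o) in
    exchange s k k = 0 -> vA != 0 ->
    fraction_value eval1 (cluster s k) vA -> fraction_value eval1 (cluster s j) vB ->
  fraction_value eval1 (cluster (mutation k s) k)
    ((laurent_monomial y_var (trop_pos (coeffs s k)) * vB ^+ `|pos_part (exchange s j k)|
      + laurent_monomial y_var (trop_neg (coeffs s k)) * vB ^+ `|pos_part (- exchange s j k)|)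
     / vA).
Proof.
move=> k j Ekk vAn sA sB; rewrite /mutation /mutate_cluster /= ffunE eqxx.
rewrite !(prod_vertex _ o) -/k -/j Ekk oppr0.
have -> : pos_part 0 = 0 by rewrite /pos_part maxxx.
have posE (z : int) : exists n : nat, pos_part z = n.
  by exists `|pos_part z|%N; rewrite /pos_part; lia.
have [n1 ->] := posE (exchange s j k); have [n2 ->] := posE (- exchange s j k).
rewrite expr0z !mul1r -!exprnP !absz_nat.
set d := coeffs s k; set m := trop_add d 0.
have -> : (laurent_monomial y_var (trop_pos d) * vB ^+ n1
           + laurent_monomial y_var (trop_neg d) * vB ^+ n2) / vA
   = (QP_of_Trop d * vB ^+ n1 + vB ^+ n2) * (QP_of_Trop m * vA)^-1.
  rewrite -[QP_of_Trop]/(laurent_monomial y_var) /trop_pos /trop_neg -/m.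
  rewrite (laurent_monomialD y_var_neq0) !laurent_monomialN.
  exact: factor_inverse.
have QPn e : QP_of_Trop e != 0.
  exact: (laurent_monomial_neq0 y_var_neq0).
apply: fraction_valueM; last first.
  apply: fraction_valueV; first exact: mulf_neq0 (QPn m) vAn.
  exact: fraction_valueM (fraction_value_const _) sA.
apply: fraction_valueD; last exact: fraction_valueX.
exact: fraction_valueM (fraction_value_const _) (fraction_valueX _ sB).
Qed.

(** * Seeds along the tree *)

(** In rank 2 a mutation changes only the sign of the exchange matrix. *)
Definition signed_exchange b c (o : bool) : 'M[int]_2 :=
  if o then - exchange_matrix b c else exchange_matrix b c.

Lemma signed_exchange_diag b c o i : signed_exchange b c o i i = 0.
Proof.
by rewrite /signed_exchange; case: o; rewrite !mxE; case: i => [[|[|]]] //= _; rewrite ?oppr0.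
Qed.

Lemma signed_exchange_row b c o :
  signed_exchange b c o (vertex_index o) (vertex_index (~~ o)) = if o then c else b.
Proof. by case: o; rewrite /signed_exchange /= !mxE //= opprK. Qed.

Lemma signed_exchange_col b c o :
  signed_exchange b c o (vertex_index (~~ o)) (vertex_index o) = - (if o then b else c)%:Z.
Proof. by case: o; rewrite /signed_exchange /= !mxE. Qed.

Lemma signed_exchangeN b c o : signed_exchange b c (~~ o) = - signed_exchange b c o.
Proof. by case: o; rewrite /signed_exchange /= ?opprK. Qed.

Lemma pos_part_nat (n : nat) : pos_part n = n.
Proof. by rewrite /pos_part; lia. Qed.

Lemma pos_part_oppn (n : nat) : pos_part (- n%:Z) = 0.
Proof. by rewrite /pos_part; lia. Qed.

Lemma vertex_cases o (i : 'I_2) : i = vertex_index o \/ i = vertex_index (~~ o).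
Proof. by case: o i => [] [[|[|]]] //= H; [right|left|left|right]; apply: val_inj. Qed.

Lemma mutate_signed_exchange b c o o' :
  mutate_matrix (vertex_index o) (signed_exchange b c o') = signed_exchange b c (~~ o').
Proof.
rewrite signed_exchangeN; apply/matrixP => i j; rewrite !mxE.
have nk : vertex_index (~~ o) == vertex_index o = false by exact: vertex_index_neq.
case: (vertex_cases o i) => ->; first by rewrite eqxx.
case: (vertex_cases o j) => ->; first by rewrite eqxx orbT.
rewrite nk /= !signed_exchange_diag oppr0 add0r.
have [-> | ->] : o' = o \/ o' = ~~ o by case: (o) (o') => [] []; auto.
  by rewrite signed_exchange_row signed_exchange_col !pos_part_oppn mul0r mulr0 addr0.
have := signed_exchange_row b c (~~ o); have := signed_exchange_col b c (~~ o).
rewrite negbK => -> ->; rewrite pos_part_nat opprK pos_part_nat.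
by rewrite mulrN mulrC addNr.
Qed.

(** What remains of a seed at x_1 = x_2 = 1, its exchange matrix being known: the
    values and the coefficients at the vertex which is mutated next (own) and at
    the other one. *)
Record seed_values := SeedValues {
  val_own : QP;
  val_other : QP;
  coeff_own : Trop;
  coeff_other : Trop
}.

Definition in_state b c (o : bool) (s : seed) (st : seed_values) : Prop :=
  [/\ fraction_value eval1 (cluster s (vertex_index o)) (val_own st),
      fraction_value eval1 (cluster s (vertex_index (~~ o))) (val_other st),
      coeffs s (vertex_index o) = coeff_own st,
      coeffs s (vertex_index (~~ o)) = coeff_other st
    & exchange s = signed_exchange b c o].

Definition new_value (e : nat) (st : seed_values) : QP :=
  (laurent_monomial y_var (trop_pos (coeff_own st))
   + laurent_monomial y_var (trop_neg (coeff_own st)) * val_other st ^+ e) / val_own st.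

Definition advance b c (o : bool) (st : seed_values) : seed_values :=
  SeedValues (val_other st) (new_value (if o then b else c) st)
         (coeff_other st + trop_pos (coeff_own st) *+ (if o then c else b)) (- coeff_own st).

Lemma minN (x : int) : - x - Num.min (- x) 0 = - Num.min x 0.
Proof. lia. Qed.

Lemma trop_posN d : trop_pos (- d) = trop_neg d.
Proof. apply/rowP => j; rewrite !mxE; exact: minN. Qed.

Lemma trop_negN d : trop_neg (- d) = trop_pos d.
Proof. by rewrite -trop_posN opprK. Qed.

Lemma mutate_other_coeff o s : 
  coeffs (mutation (vertex_index o) s) (vertex_index (~~ o))
  = coeffs s (vertex_index (~~ o))
    + coeffs s (vertex_index o) *~ pos_part (exchange s (vertex_index o) (vertex_index (~~ o)))
    + trop_add (coeffs s (vertex_index o)) 0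
      *~ (- exchange s (vertex_index o) (vertex_index (~~ o))).
Proof. by rewrite /mutation /mutate_coeffs /= ffunE vertex_index_neq. Qed.

Lemma mutate_own_coeff k s : coeffs (mutation k s) k = - coeffs s k.
Proof. by rewrite /mutation /mutate_coeffs /= ffunE eqxx. Qed.

Lemma mutate_other_cluster o s :
  cluster (mutation (vertex_index o) s) (vertex_index (~~ o)) = cluster s (vertex_index (~~ o)).
Proof. by rewrite /mutation /mutate_cluster /= ffunE vertex_index_neq. Qed.

Lemma in_state_forward b c o s st : val_own st != 0 -> in_state b c o s st ->
  in_state b c (~~ o) (mutation (vertex_index o) s) (advance b c o st).
Proof.
move=> An [sA sB dE d'E exE]; rewrite /in_state negbK.
rewrite mutate_other_coeff mutate_own_coeff mutate_other_cluster dE d'E exE.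
rewrite signed_exchange_row pos_part_nat.
split; [exact: sB | | | reflexivity | ]; last first.
- by rewrite /mutation /= exE mutate_signed_exchange.
- rewrite /advance /= mulrNz -addrA; congr (_ + _).
  by rewrite -!pmulrn /trop_pos mulrnBl.
have := mutate_cluster_value (o := o) _ An sA sB.
rewrite exE signed_exchange_diag signed_exchange_col opprK pos_part_nat pos_part_oppn.
by rewrite dE expr0 mulr1 absz_nat; apply.
Qed.

Lemma divf_swap (K : fieldType) (x a : K) : a != 0 -> x / a != 0 -> x / (x / a) = a.
Proof.
move=> an xan; have xn : x != 0 by apply: contraNneq xan => ->; rewrite mul0r.
by rewrite invf_div mulrCA divff ?mulr1.
Qed.

(** Mutations are involutive, so the relation between the states at t and t + 1
    also determines the former from the latter. *)
Lemma in_state_backward b c o s st : val_own st != 0 -> val_other (advance b c o st) != 0 ->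
  in_state b c (~~ o) s (advance b c o st) ->
  in_state b c o (mutation (vertex_index o) s) st.
Proof.
move=> An Bn; rewrite /in_state negbK => -[sB sA d'E dE exE].
rewrite mutate_other_coeff mutate_own_coeff mutate_other_cluster dE d'E exE.
rewrite signed_exchangeN mxE signed_exchange_row pos_part_oppn mulr0z addr0.
split; [ | exact: sB | exact: opprK | | ]; last first.
- by rewrite /mutation /= exE mutate_signed_exchange negbK.
- rewrite /advance /= -addrA opprK -pmulrn.
  have -> : trop_add (- coeff_own st) 0 = - trop_pos (coeff_own st).
    by rewrite -trop_negN /trop_neg opprK.
  by rewrite mulNrn subrr addr0.
have := mutate_cluster_value (o := o) _ Bn sA sB.
rewrite exE signed_exchangeN !mxE signed_exchange_diag signed_exchange_col opprK.
rewrite pos_part_nat pos_part_oppn dE absz_nat trop_posN trop_negN expr0 mulr1.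
move=> /(_ (oppr0 _)); congr (fraction_value _ _ _).
rewrite [X in X / _]addrC; exact: (divf_swap An Bn).
Qed.

Lemma odd_abszS (t : int) : odd `|t + 1| = ~~ odd `|t|.
Proof.
case: t => [n | n]; first by rewrite -PoszD absz_nat addn1.
have -> : Negz n + 1 = - n%:Z by lia.
by rewrite abszN absz_nat /= negbK.
Qed.

(** Both directions of the tree are covered, although st is only compared with
    the mutations from t to t + 1. *)
Theorem pattern_states b c Sigma (st : int -> seed_values) :
    cluster_pattern Sigma -> Sigma 0 = principal_seed (exchange_matrix b c) ->
    st 0 = SeedValues 1 1 (delta_mx 0 0) (delta_mx 0 1) ->
    (forall t, st (t + 1) = advance b c (odd `|t|) (st t)) ->
    (forall t, val_own (st t) != 0) ->
  forall t, in_state b c (odd `|t|) (Sigma t) (st t).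
Proof.
move=> [_ mutS] S0 st0 stS An.
have Bn t : val_other (st t) != 0.
  by have := An (t + 1); rewrite stS.
have base : in_state b c (odd `|0%:Z|) (Sigma 0) (st 0).
  rewrite S0 st0; split=> //=; rewrite ?ffunE //.
  - by have := fraction_value_poly eval1 ('X_0); rewrite /eval1 /= mevalXU.
  by have := fraction_value_poly eval1 ('X_1); rewrite /eval1 /= mevalXU.
have up t : in_state b c (odd `|t|) (Sigma t) (st t) ->
    in_state b c (odd `|t + 1|) (Sigma (t + 1)) (st (t + 1)).
  by have [-> _] := mutS t; rewrite odd_abszS stS; apply: in_state_forward; apply: An.
have down t : in_state b c (odd `|t + 1|) (Sigma (t + 1)) (st (t + 1)) ->
    in_state b c (odd `|t|) (Sigma t) (st t).
  have [_ ->] := mutS t; rewrite odd_abszS stS; apply: in_state_backward; first exact: An.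
  by rewrite -stS; apply: Bn.
have pos n : in_state b c (odd `|n%:Z|) (Sigma n%:Z) (st n%:Z).
  by elim: n => // n IH; rewrite -addn1 PoszD; apply: up.
have neg n : in_state b c (odd `|- n%:Z|) (Sigma (- n%:Z)) (st (- n%:Z)).
  elim: n => [|n IH]; first by rewrite oppr0.
  apply: down; have -> : - n.+1%:Z + 1 = - n%:Z by lia.
  exact: IH.
by case=> n; [exact: pos | rewrite NegzE; exact: neg].
Qed.

(** * Positivity and exponents *)

Section PositiveFractions.
Variables (A : idomainType) (ev : {rmorphism A -> int}).

Definition positive_fraction (z : {fraction A}) : Prop :=
  exists p q : A, [/\ 0 < ev p, 0 < ev q & z = tofrac p / tofrac q].

Lemma tofrac_pos_neq0 (r : A) : 0 < ev r -> tofrac r != 0.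
Proof.
by move=> r_gt0; rewrite tofrac_eq0; apply: contraTneq r_gt0 => ->; rewrite rmorph0.
Qed.

Lemma positive_fraction_cone : positive_cone positive_fraction.
Proof.
split.
- by exists 1, 1; rewrite !rmorph1 divr1.
- move=> _ _ [p [q [p0 q0 ->]]] [p' [q' [p0' q0' ->]]].
  exists (p * q' + p' * q), (q * q'); rewrite !rmorphD !rmorphM.
  by rewrite addr_gt0 ?mulr_gt0 // addf_div ?tofrac_pos_neq0.
- move=> _ _ [p [q [p0 q0 ->]]] [p' [q' [p0' q0' ->]]].
  by exists (p * p'), (q * q'); rewrite !rmorphM !mulr_gt0 // mulf_div.
- by move=> _ [p [q [p0 q0 ->]]]; exists q, p; rewrite invf_div.
by move=> _ [p [q [p0 q0 ->]]]; rewrite mulf_neq0 ?invr_eq0 ?tofrac_pos_neq0.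
Qed.
End PositiveFractions.

Definition vec2 (p q : int) : Trop := \row_j (if j == 0 then p else q).

Lemma vec2P (d : Trop) p q : d 0 0 = p -> d 0 1 = q -> d = vec2 p q.
Proof.
move=> d0 d1; apply/rowP => j; rewrite mxE.
by case: j => [[|[|]]] //= H; rewrite -?d0 -?d1; congr (d _ _); apply: val_inj.
Qed.

Lemma vec2D p q p' q' : vec2 p q + vec2 p' q' = vec2 (p + p') (q + q').
Proof. by apply: vec2P; rewrite !mxE. Qed.

Lemma vec2N p q : - vec2 p q = vec2 (- p) (- q).
Proof. by apply: vec2P; rewrite !mxE. Qed.

Lemma vec2Mn p q n : vec2 p q *+ n = vec2 (p *+ n) (q *+ n).
Proof. by apply: vec2P; rewrite mulmxnE !mxE. Qed.

Lemma vec2_0 : vec2 0 0 = 0.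
Proof. by symmetry; apply: vec2P; rewrite mxE. Qed.

Lemma trop_pos_nat (p q : nat) : trop_pos (vec2 p q) = vec2 p q.
Proof. by apply: vec2P; rewrite !mxE /= ?min_r ?subr0. Qed.

Lemma trop_neg_nat (p q : nat) : trop_neg (vec2 p q) = 0.
Proof. by rewrite -vec2_0; apply: vec2P; rewrite !mxE /= ?min_r ?oppr0. Qed.

Lemma trop_pos_opp (p q : nat) : trop_pos (vec2 (- p%:Z) (- q%:Z)) = 0.
Proof. by rewrite -vec2N trop_posN trop_neg_nat. Qed.

Lemma trop_neg_opp (p q : nat) : trop_neg (vec2 (- p%:Z) (- q%:Z)) = vec2 p q.
Proof. by rewrite -vec2N trop_negN trop_pos_nat. Qed.

Section LaurentVec2.
Variables (K : fieldType) (y : 'I_2 -> K).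

Lemma laurent_vec2 (p q : nat) :
  laurent_monomial y (vec2 p q) = y 0 ^+ p * y 1 ^+ q.
Proof.
by rewrite /laurent_monomial (prod_vertex _ false) !mxE /=.
Qed.

Lemma laurent_0 : laurent_monomial y 0 = 1.
Proof. by rewrite -vec2_0 -[0]/(Posz 0) laurent_vec2 mulr1. Qed.
End LaurentVec2.

(** As rows of integers the denominator vectors start with that of x_2. *)
Definition dvec_row b c n : Trop :=
  if n is 0 then vec2 0 (-1) else vec2 (dvec b c n).1 (dvec b c n).2.

(** The coefficient at the n-th step; it is also defined, and then negative, when
    the next denominator vector is that of an initial variable. *)
Definition dvec_next b c n : Trop :=
  if n is m.+1 then dvec_row b c n *+ exchange_exponent b c n - dvec_row b c m
  else vec2 1 0.

Lemma dvec_next_genuine b c n : genuine b c n.+1 -> dvec_next b c n = dvec_row b c n.+1.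
Proof.
case: n => [|[|n]] gen //.
  rewrite /dvec_next /dvec_row /= vec2Mn vec2N vec2D /=; congr vec2; by rewrite /exchange_exponent /=; lia.
have e1 := dvec_rec1 gen; have e2 := dvec_rec2 gen.
rewrite /dvec_next /dvec_row vec2Mn vec2N vec2D; congr vec2; rewrite -mulr_natr natz -PoszM mulnC.
  by rewrite -e1 PoszD addrK.
by rewrite -e2 PoszD addrK.
Qed.

Definition y1 : QP := y_var 0.
Definition y2 : QP := y_var 1.

Definition posQP : QP -> Prop :=
  positive_fraction (meval (fun=> 1 : int) : {rmorphism {mpoly int[2]} -> int}).

Lemma posQP_cone : positive_cone posQP.
Proof. exact: positive_fraction_cone. Qed.

Lemma posQP_y j : posQP (y_var j).
Proof.
by exists 'X_j, 1; rewrite /= mevalXU meval1 tofrac1 divr1.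
Qed.

(** * The two half-lines of seeds *)

Lemma advance_nat b c o A B (p q : nat) d' :
  advance b c o (SeedValues A B (vec2 p q) d') =
  SeedValues B ((y1 ^+ p * y2 ^+ q + B ^+ (if o then b else c)) / A)
    (d' + vec2 p q *+ (if o then c else b)) (vec2 (- p%:Z) (- q%:Z)).
Proof.
rewrite /advance /new_value /val_own /val_other /coeff_own /coeff_other.
rewrite trop_pos_nat trop_neg_nat laurent_vec2 laurent_0.
by rewrite mul1r vec2N.
Qed.

Lemma advance_opp b c o A B (p q : nat) d' :
  advance b c o (SeedValues A B (vec2 (- p%:Z) (- q%:Z)) d') =
  SeedValues B ((1 + y1 ^+ p * y2 ^+ q * B ^+ (if o then b else c)) / A) d' (vec2 p q).
Proof.
rewrite /advance /new_value /val_own /val_other /coeff_own /coeff_other.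
rewrite trop_pos_opp trop_neg_opp laurent_vec2 laurent_0.
by rewrite mul0rn addr0 vec2N !opprK.
Qed.

Definition forward_value b c n : QP := forward_sum b c n y1 y2.
Definition backward_value b c n : QP := backward_sum b c n y1 y2.

Lemma forward_value_neq0 b c n : forward_value b c n != 0.
Proof.
apply: (pos_neq0 posQP_cone); apply: (pos_compatible_sum posQP_cone); exact: posQP_y.
Qed.

Lemma backward_value_neq0 b c n : backward_value b c n != 0.
Proof.
apply: (pos_neq0 posQP_cone); apply: (pos_compatible_sum posQP_cone); exact: posQP_y.
Qed.

Lemma forward_value0 b c : forward_value b c 0 = 1.
Proof. exact: compatible_sum00. Qed.

Lemma forward_value1 b c : forward_value b c 1 = 1 + y1.
Proof. exact: compatible_sum10. Qed.

Lemma backward_value1 b c : backward_value b c 1 = 1 + y2.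
Proof. exact: (compatible_sum01 _ _ (y_var_neq0 0) (y_var_neq0 1)). Qed.

Definition forward_state b c n : seed_values :=
  SeedValues (forward_value b c n.-1) (forward_value b c n) (dvec_next b c n) (- dvec_row b c n).

Definition forward_exchange_at b c n : Prop :=
  forward_value b c n.+2 * forward_value b c n
  = y1 ^+ (dvec b c n.+2).1 * y2 ^+ (dvec b c n.+2).2
    + forward_value b c n.+1 ^+ exchange_exponent b c n.+1.

Lemma eq_div (K : fieldType) (x y z : K) : z != 0 -> x * z = y -> y / z = x.
Proof. by move=> zn <-; rewrite mulfK. Qed.

Lemma advance_forward_state b c n : genuine b c n.+1 ->
    (forall m, n = m.+1 -> forward_exchange_at b c m) ->
  advance b c (odd n) (forward_state b c n) = forward_state b c n.+1.
Proof.
move=> gen exch; rewrite /forward_state (dvec_next_genuine gen).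
rewrite [dvec_row b c n.+1]/(vec2 _ _) advance_nat; congr SeedValues; last by rewrite vec2N.
  case: n gen exch => [|n] gen exch.
    rewrite forward_value0 divr1 expr1n forward_value1 /= expr1 expr0 mulr1.
    exact: addrC.
  apply: eq_div; first exact: forward_value_neq0.
  exact: exch.
rewrite addrC -[vec2 _ _]/(dvec_row b c n.+1) [dvec_next b c n.+1]/(_ - _).
congr (_ *+ _ - _); rewrite /exchange_exponent /=; by case: (odd n).
Qed.

Definition backward_row b c n : Trop :=
  if n is 0 then vec2 (-1) 0 else vec2 (dvec c b n).2 (dvec c b n).1.

(** The state at the vertex - (m + 1). *)
Definition backward_state b c m : seed_values :=
  if m is m'.+1 then SeedValues (backward_value b c m.+1) (backward_value b c m)
     (backward_row b c m') (- backward_row b c m)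
  else SeedValues (backward_value b c 1) 1 (vec2 0 (-1)) (vec2 1 0).

(** Read from t to t + 1, a step towards the initial seed divides the same
    exchange relation by the other of its two cluster variables. *)
Lemma advance_backward_state b c m : (0 < b)%N -> (0 < c)%N -> (forall N, genuine b c N) ->
  advance b c (odd m) (backward_state b c m.+1) = backward_state b c m.
Proof.
move=> b_gt0 c_gt0 gen; rewrite /backward_state.
have vecN (p q : nat) : vec2 (- p%:Z) (- q%:Z) = - vec2 p q by rewrite vec2N.
case: m => [|m].
  rewrite -[backward_row b c 0]/(vec2 (- 1%:Z) (- 0%:Z)) advance_opp -vecN.
  congr SeedValues.
  apply: eq_div; first exact: backward_value_neq0.
  rewrite mul1r expr1 expr0 mulr1.
  exact: (backward_exchange0 posQP_cone b_gt0 c_gt0 (posQP_y 0) (posQP_y 1)).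
rewrite [backward_row b c m.+1]/(vec2 _ _) advance_nat; congr SeedValues; last by rewrite vecN.
  apply: eq_div; first exact: backward_value_neq0.
  rewrite mulrC.
  have := backward_exchange posQP_cone b_gt0 c_gt0 (gen m.+3) (posQP_y 0) (posQP_y 1).
  rewrite /exchange_exponent /= negbK mulrC.
  by case: (odd m).
apply/eqP; rewrite addrC subr_eq [_ + backward_row b c m.+2]addrC; apply/eqP.
have -> : (if odd m.+1 then c else b) = exchange_exponent c b m.+1.
  by rewrite /exchange_exponent; case: (odd _).
have genC := genuineC (gen m.+3); have gen2 := genuineS genC.
case: m genC gen2 => [|m] genC gen2.
  rewrite /backward_row vec2Mn vec2D; congr vec2; rewrite /exchange_exponent /=; lia.
rewrite /backward_row vec2Mn vec2D; congr vec2; rewrite -mulr_natr natz -PoszM mulnC.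
  by rewrite -dvec_rec2 // PoszD.
by rewrite -dvec_rec1 // PoszD.
Qed.

(** * Finite and infinite type *)

Definition compatible_value b c (v : QP) : Prop :=
  exists a1 a2, v = compatible_sum b c a1 a2 y1 y2.

Lemma compatible_value_neq0 b c v : compatible_value b c v -> v != 0.
Proof.
case=> a1 [a2 ->]; apply: (pos_neq0 posQP_cone).
apply: (pos_compatible_sum posQP_cone); exact: posQP_y.
Qed.

Lemma compatible_value1 b c : compatible_value b c 1.
Proof. by exists 0%N, 0%N; rewrite compatible_sum00. Qed.

Lemma compatible_forward b c n : compatible_value b c (forward_value b c n).
Proof. by exists (dvec b c n).1, (dvec b c n).2. Qed.

Lemma compatible_backward b c n : compatible_value b c (backward_value b c n).
Proof. by exists (dvec c b n).2, (dvec c b n).1. Qed.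

Definition compatible_state b c st : Prop :=
  compatible_value b c (val_own st) /\ compatible_value b c (val_other st).

Lemma compatible_forward_state b c n : compatible_state b c (forward_state b c n).
Proof. by split; apply: compatible_forward. Qed.

Lemma delta_vec2_0 : delta_mx 0 0 = vec2 1 0.
Proof. by apply: vec2P; rewrite mxE. Qed.

Lemma delta_vec2_1 : delta_mx 0 1 = vec2 0 1.
Proof. by apply: vec2P; rewrite mxE. Qed.

Lemma forward_state0 b c :
  forward_state b c 0 = SeedValues 1 1 (delta_mx 0 0) (delta_mx 0 1).
Proof.
by rewrite /forward_state forward_value0 delta_vec2_0 delta_vec2_1 /dvec_row vec2N oppr0 opprK.
Qed.

Lemma pattern_values b c Sigma (st : int -> seed_values) :
    cluster_pattern Sigma -> Sigma 0 = principal_seed (exchange_matrix b c) ->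
    st 0 = forward_state b c 0 ->
    (forall t, st (t + 1) = advance b c (odd `|t|) (st t)) ->
    (forall t, compatible_state b c (st t)) ->
  forall t i, exists2 v, compatible_value b c v
                       & fraction_value eval1 (cluster (Sigma t) i) v.
Proof.
move=> patS S0 st0 stS cst t i.
have An s : val_own (st s) != 0 by exact: compatible_value_neq0 (cst s).1.
rewrite forward_state0 in st0.
have [sA sB _ _ _] := pattern_states patS S0 st0 stS An t.
case: (vertex_cases (odd `|t|) i) => ->; first by exists (val_own (st t)) => //; exact: (cst t).1.
by exists (val_other (st t)) => //; exact: (cst t).2.
Qed.

(** Negz m is the integer - (m + 1). *)
Definition infinite_state b c (t : int) : seed_values :=
  match t with Posz n => forward_state b c n | Negz m => backward_state b c m end.

Lemma advance_backward_state0 b c o :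
  advance b c o (backward_state b c 0) = forward_state b c 0.
Proof.
rewrite /backward_state -[vec2 0 (-1)]/(vec2 (- 0%:Z) (- 1%:Z)) advance_opp.
rewrite forward_state0 expr1n mulr1 expr0 mul1r expr1 backward_value1.
rewrite divff; last by rewrite -(backward_value1 b c); exact: backward_value_neq0.
by rewrite delta_vec2_0 delta_vec2_1.
Qed.

Lemma infinite_values b c Sigma : (0 < b)%N -> (0 < c)%N ->
    (forall N, genuine b c N) ->
    cluster_pattern Sigma -> Sigma 0 = principal_seed (exchange_matrix b c) ->
  forall t i, exists2 v, compatible_value b c v
                       & fraction_value eval1 (cluster (Sigma t) i) v.
Proof.
move=> b_gt0 c_gt0 gen patS S0.
apply: (pattern_values (st := infinite_state b c) patS S0) => //.
  case=> [n | [|m]].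
  - rewrite -PoszD addn1 absz_nat /infinite_state advance_forward_state // => m _.
    exact: (forward_exchange posQP_cone b_gt0 c_gt0 (gen _) (posQP_y 0) (posQP_y 1)).
  - by rewrite -[Negz 0 + 1]/(Posz 0) /infinite_state advance_backward_state0.
  - have -> : Negz m.+1 + 1 = Negz m by lia.
    by rewrite /infinite_state -advance_backward_state //= negbK.
case=> [n | [|m]]; first exact: compatible_forward_state.
  by split; [exact: compatible_backward | exact: compatible_value1].
by split; exact: compatible_backward.
Qed.

(** The states of one period: after the variable with denominator vector (0, 1),
    the two initial variables come back, one after the other. *)
Definition finite_state b c N (j : nat) : seed_values :=
  if (j <= N)%N then forward_state b c j
  else SeedValues (forward_value b c N) 1 (vec2 0 (-1)) (vec2 1 0).

(** The data of a pattern of finite type with N + 1 cluster variables which are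
    not initial. Its seeds have period N + 3, up to exchange of the two vertices
    when N + 3 is odd. *)
Record finite_period b c N : Prop := FinitePeriod {
  period_genuine : genuine b c N.+1;
  period_parity : odd N.+1 -> b = c;
  period_last : dvec b c N.+1 = (0, 1)%N;
  period_next : dvec_next b c N.+1 = vec2 (-1) 0;
  period_exchange : forall m, (m < N)%N -> forward_exchange_at b c m;
  period_closing : forward_value b c N = 1 + y1 * (1 + y2) ^+ exchange_exponent b c N.+1
}.

Lemma advance_parity b c o o' st : o = o' \/ b = c -> advance b c o st = advance b c o' st.
Proof. by rewrite /advance => -[-> // | ->]; rewrite !if_same. Qed.

Lemma advance_finite_state b c N j : finite_period b c N -> (j < N.+3)%N ->
  advance b c (odd j) (finite_state b c N.+1 j)
  = finite_state b c N.+1 (if j == N.+2 then 0%N else j.+1).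
Proof.
move=> per lt_j.
have lastE : forward_value b c N.+1 = 1 + y2.
  rewrite /forward_value /forward_sum (period_last per).
  exact: (compatible_sum01 _ _ (y_var_neq0 0) (y_var_neq0 1)).
have [lt_jN | le_Nj] := ltnP j N.+1.
  have -> : (j == N.+2) = false by lia.
  have le_j : (j <= N.+1)%N by lia.
  rewrite /finite_state le_j lt_jN advance_forward_state //.
    by move=> m m_j; apply: (period_genuine per); lia.
  by move=> m def_j; apply: (period_exchange per); lia.
have [-> | ->] : j = N.+1 \/ j = N.+2 by lia.
  have -> : (N.+1 == N.+2) = false by lia.
  rewrite /finite_state leqnn ltnn /forward_state (period_next per).
  rewrite -[vec2 (-1) 0]/(vec2 (- 1%:Z) (- 0%:Z)) advance_opp.
  congr SeedValues; last by rewrite /dvec_row (period_last per) vec2N.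
  apply: eq_div; first exact: forward_value_neq0.
  by rewrite mul1r expr1 expr0 mulr1 lastE [N.+1.-1]/= (period_closing per).
rewrite eqxx /finite_state ltnn -[vec2 0 (-1)]/(vec2 (- 0%:Z) (- 1%:Z)) advance_opp.
rewrite forward_state0 expr1n mulr1 expr0 mul1r expr1 lastE.
rewrite divff; last by rewrite -lastE; exact: forward_value_neq0.
by rewrite delta_vec2_0 delta_vec2_1.
Qed.

Lemma odd_abszD (s t : int) : odd `|s + t| = odd `|s| (+) odd `|t|.
Proof. lia. Qed.

Lemma finite_values b c N Sigma : finite_period b c N ->
    cluster_pattern Sigma -> Sigma 0 = principal_seed (exchange_matrix b c) ->
  forall t i, exists2 v, compatible_value b c v
                       & fraction_value eval1 (cluster (Sigma t) i) v.
Proof.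
move=> per patS S0.
pose st (t : int) := finite_state b c N.+1 `|(t %% N.+3%:Z)%Z|.
apply: (pattern_values (st := st) patS S0) => //; last first.
  move=> t; rewrite /st /finite_state; case: ifP => _; first exact: compatible_forward_state.
  by split; [exact: compatible_forward | exact: compatible_value1].
move=> t; rewrite /st; set r := `|(t %% _)%Z|%N.
have rE : (t %% N.+3%:Z)%Z = r by rewrite /r gez0_abs // modz_ge0.
have lt_r : (r < N.+3)%N by rewrite -ltz_nat -rE ltz_mod.
have -> : `|((t + 1) %% N.+3%:Z)%Z|%N = if r == N.+2 then 0%N else r.+1.
  rewrite -modzDml rE -PoszD modz_nat absz_nat addn1; case: eqP => [->|ne].
    by rewrite modnn.
  by rewrite modn_small //; lia.
rewrite -advance_finite_state //; apply: advance_parity.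
case: (boolP (odd N.+1)) => [/(period_parity per) | even]; [by right | left].
have := congr1 (fun s : int => odd `|s|%N) (divz_eq t N.+3%:Z).
rewrite rE (odd_abszD (_ * _)) abszM !absz_nat oddM => ->.
have -> : odd N.+3 = odd N.+1 by rewrite /= !negbK.
by rewrite (negPf even) andbF.
Qed.

(** For b * c >= 4 this inequality passes from each vector to the next one, and it
    implies that no subtraction in dvec is truncated. *)
Lemma dvec_large b c n : (4 <= b * c)%N -> (2 * (dvec b c n.+1).2 <= c * (dvec b c n.+1).1)%N.
Proof.
elim: n b c => [|n IH] b c bc4; first by rewrite /= muln0.
have := IH c b; rewrite mulnC => /(_ bc4); rewrite dvecSS.
set p := (dvec c b n.+1).1; set q := (dvec c b n.+1).2 => le_q.
rewrite [(_, _).1]/= [(_, _).2]/= mulnBr leq_subRL; last by nia.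
nia.
Qed.

Lemma genuine_large b c N : (4 <= b * c)%N -> genuine b c N.
Proof.
move=> bc4 [//|m] _; split.
  by have := dvec_large m bc4; lia.
by rewrite mulnC in bc4; have := dvec_large m bc4; lia.
Qed.

Lemma finite_period_pos b c N : (0 < b)%N -> (0 < c)%N -> genuine b c N.+2 ->
    (odd N.+2 -> b = c) -> dvec b c N.+1 = (1, c)%N -> dvec b c N.+2 = (0, 1)%N ->
    exchange_exponent b c N.+2 = c ->
  finite_period b c N.+1.
Proof.
move=> b_gt0 c_gt0 gen par d1 d2 e2; split=> //.
- rewrite /dvec_next /dvec_row d1 d2 e2 vec2Mn vec2N vec2D; congr vec2; rewrite -mulr_natr natz /=; lia.
- move=> m lt_m.
  apply: (forward_exchange posQP_cone b_gt0 c_gt0 _ (posQP_y 0) (posQP_y 1)).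
  by move=> k lt_k; apply: gen; lia.
rewrite e2 -(backward_value1 b c) /forward_value /forward_sum d1.
have := backward_exchange0 posQP_cone b_gt0 c_gt0 (posQP_y 0) (posQP_y 1).
by rewrite {1}/backward_sum /= muln1 subn0.
Qed.

(** Type A_1 x A_1. *)
Lemma finite_period00 : finite_period 0 0 1.
Proof.
split=> //.
- by case=> [|[|m]].
- rewrite /dvec_next /dvec_row /exchange_exponent /= mulr0n add0r vec2N; congr vec2.
- case=> // _; rewrite /forward_exchange_at forward_value0 mulr1 expr0 expr1 mul1r.
  rewrite /forward_value /forward_sum /= addrC.
  exact: (compatible_sum01 _ _ (y_var_neq0 0) (y_var_neq0 1)).
by rewrite forward_value1 /exchange_exponent /= expr0 mulr1.
Qed.

(** Types A_2, B_2 and G_2. *)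
Lemma finite_period_small b c : (0 < b)%N -> (0 < c)%N -> (b * c < 4)%N ->
  exists N, finite_period b c N.
Proof.
move=> b_gt0 c_gt0 bc4.
have : (b, c) \in [:: (1, 1); (1, 2); (2, 1); (1, 3); (3, 1)]%N.
  have [le_b le_c] : (b <= 3 /\ c <= 3)%N by nia.
  by move: b c b_gt0 c_gt0 bc4 le_b le_c => [|[|[|[|b]]]] [|[|[|[|c]]]].
rewrite !inE => /or4P[/eqP[-> ->] | /eqP[-> ->] | /eqP[-> ->] | /orP[] /eqP[-> ->]].
- by exists 2; apply: finite_period_pos => //; case=> [|[|[|m]]].
- by exists 3; apply: finite_period_pos => //; case=> [|[|[|[|m]]]].
- by exists 3; apply: finite_period_pos => //; case=> [|[|[|[|m]]]].
- by exists 5; apply: finite_period_pos => //; case=> [|[|[|[|[|[|m]]]]]].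
by exists 5; apply: finite_period_pos => //; case=> [|[|[|[|[|[|m]]]]]].
Qed.

(** The matrix is skew-symmetrizable, so that b and c vanish together. *)
Lemma cluster_values b c Sigma : cluster_pattern Sigma ->
    Sigma 0 = principal_seed (exchange_matrix b c) ->
  forall t i, exists a1 a2, 
    fraction_value eval1 (cluster (Sigma t) i) (compatible_sum b c a1 a2 y1 y2).
Proof.
move=> patS S0 t i.
(* Compare the entries (0, 1) in the skew-symmetry of diag(d) B. *)
have zero_iff : (b == 0%N) = (c == 0%N).
  have [_ [d [d_gt0 /matrixP/(_ 0 1)]]] := patS.1 0.
  rewrite S0 /= !mul_diag_mx !mxE /= => eq_bc.
  apply/eqP/eqP => [b0 | c0].
    move: eq_bc; rewrite b0 mulr0 oppr0 mulrN => /eqP.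
    by rewrite oppr_eq0 mulf_eq0 gt_eqF ?d_gt0 //= => /eqP[].
  move: eq_bc; rewrite c0 oppr0 mulr0 => /esym/eqP.
  by rewrite oppr_eq0 mulf_eq0 gt_eqF ?d_gt0 //= => /eqP[].
suff [v [a1 [a2 ->]] sv] : exists2 v, compatible_value b c v
   & fraction_value eval1 (cluster (Sigma t) i) v by exists a1, a2.
have [b0 | b_gt0] := posnP b.
  have c0 : c = 0%N by apply/eqP; rewrite -zero_iff b0.
  rewrite {}b0 {}c0 in S0 *; exact: finite_values finite_period00 patS S0 t i.
have c_gt0 : (0 < c)%N by rewrite lt0n -zero_iff -lt0n.
have [bc4 | /(finite_period_small b_gt0 c_gt0)[N per]] := leqP 4 (b * c).
  by apply: infinite_values patS S0 t i => // N; apply: genuine_large.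
exact: finite_values per patS S0 t i.
Qed.

(** * F-polynomials and their degrees *)

Lemma tofrac_compatible_sum b c a1 a2 :
  tofrac (compatible_sum b c a1 a2 ('X_0 : {mpoly int[2]}) 'X_1)
  = compatible_sum b c a1 a2 y1 y2.
Proof.
rewrite /compatible_sum rmorph_sum; apply: eq_bigr => S _.
by rewrite rmorphM !rmorphXn.
Qed.

Lemma F_polynomial_unique Sigma i t (P : {mpoly int[2]}) :
  fraction_value eval1 (cluster (Sigma t) i) (tofrac P) -> F_polynomial Sigma i t = P.
Proof.
move=> valP; rewrite /F_polynomial.
have : exists P : {mpoly int[2]}, specialized_at_1 (cluster (Sigma t) i) (tofrac P).
  by exists P.
move/(epsilon_spec (inhabits 0)); set P' := epsilon _ _ => valP'.
by apply/eqP; rewrite -tofrac_eq; apply/eqP; exact: fraction_value_uniq valP' valP.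
Qed.

Section Degree.
Variables (b c a1 a2 : nat).
Let w := maximal_Dyck_path a1 a2.

Definition pair_exponent (S : {set 'I_(a1 + a2)} * {set 'I_(a1 + a2)}) : 'X_{1..2} :=
  (mnm1 (0 : 'I_2)%R *+ (a1 - #|S.1|) + mnm1 (1 : 'I_2)%R *+ #|S.2|)%MM.

Lemma compatible_sum_mpoly :
  compatible_sum b c a1 a2 ('X_0 : {mpoly int[2]}) 'X_1
  = \sum_(S | compatible_pair b c w S) 'X_[pair_exponent S].
Proof. by apply: eq_bigr => S _; rewrite mpolyXD !mpolyXn. Qed.

(** No cancellation takes place. *)
Lemma msupp_compatible_sum m :
  (m \in msupp (compatible_sum b c a1 a2 ('X_0 : {mpoly int[2]}) 'X_1))
  = [exists S, compatible_pair b c w S && (pair_exponent S == m)].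
Proof.
rewrite mcoeff_msupp compatible_sum_mpoly raddf_sum /=.
under eq_bigr => S _ do rewrite mcoeffX.
apply/idP/existsP => [nz | [S /andP[cS /eqP Sm]]].
  case: (pickP (fun S => compatible_pair b c w S && (pair_exponent S == m))) => [S cS | none].
    by exists S.
  rewrite big1 ?eqxx // in nz => S cS.
  by have := none S; rewrite cS /= => ->.
rewrite (bigD1 S) //= Sm eqxx; apply: lt0r_neq0.
by rewrite ltr_pwDl // sumr_ge0.
Qed.

Lemma pair_exponent0 S : pair_exponent S 0 = (a1 - #|S.1|)%N.
Proof. by rewrite mnmDE !mulmnE !mnm1E /= mul1n mul0n addn0. Qed.

Lemma pair_exponent1 S : pair_exponent S 1 = #|S.2|.
Proof. by rewrite mnmDE !mulmnE !mnm1E /= mul1n mul0n add0n. Qed.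

Lemma max_degree_compatible_sum k :
  max_degree k (compatible_sum b c a1 a2 ('X_0 : {mpoly int[2]}) 'X_1)
  = if k == 0 then a1 else a2.
Proof.
set P := compatible_sum _ _ _ _ _ _.
have cver : compatible_pair b c w (set0, vertical_edges w).
  rewrite /compatible_pair sub0set subxx /=.
  by apply/'forall_in_forall_inP => u; rewrite inE.
have card_ver : #|vertical_edges w| = a2.
  by rewrite card_vertical count_ver_Dyck.
(* This pair has the largest exponents of both variables. *)
have top : pair_exponent (set0, vertical_edges w) \in msupp P.
  by rewrite msupp_compatible_sum; apply/existsP;
     exists (set0, vertical_edges w); rewrite cver eqxx.
apply/eqP; rewrite eqn_leq; apply/andP; split.
  apply/bigmax_leqP_seq => m; rewrite msupp_compatible_sum => /existsP[S /andP[cS /eqP<-]] _.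
  case: (vertex_cases false k) => ->.
    by rewrite pair_exponent0; exact: leq_subr.
  rewrite pair_exponent1 /= -[X in (_ <= X)%N]card_ver; apply: subset_leq_card.
  by case/and3P: cS.
apply: leq_trans (leq_bigmax_seq _ top isT) => /=.
case: (vertex_cases false k) => ->.
  by rewrite pair_exponent0 cards0 subn0.
by rewrite pair_exponent1 card_ver.
Qed.
End Degree.

Theorem corollary5p7 (b c : nat) (Sigma : int -> seed)
    (hSigma : cluster_pattern Sigma)
    (h0 : Sigma 0 = principal_seed (exchange_matrix b c))
    (f : 'cV[nat]_2) (i : 'I_2) (t : int)
    (hf : f_vector Sigma i t = f) :
  F_polynomial Sigma i t =
    \sum_(S | compatible_pair b c (maximal_Dyck_path (f 0 0) (f 1 0)) S)
      'X_0 ^+ (f 0 0 - #|S.1|) * 'X_1 ^+ #|S.2|.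
Proof.
have [a1 [a2]] := cluster_values hSigma h0 t i.
rewrite -tofrac_compatible_sum => /F_polynomial_unique F_eq.
have f_eq k : f k 0 = if k == 0 then a1 else a2.
  by rewrite -hf mxE F_eq max_degree_compatible_sum.
by rewrite F_eq !f_eq.
Qed.
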